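(* For all positive integers $k$ and $n$, \[ \zeta_{\mathcal F}(k,\underbrace{1,\ldots,1}_{n-1})=\zeta_{\mathcal F}(n,\underbrace{1,\ldots,1}_{k-1})\quad\text{in } \mathcal Z/\zeta(2)\mathcal Z. \]
   Context: For positive integers $k_1,\ldots,k_n$ with $k_1\ge 2$, $\zeta(k_1,\ldots,k_n)=\sum_{m_1>m_2>\cdots>m_n\ge 1} m_1^{-k_1}\cdots m_n^{-k_n}$. Let $\mathcal Z$ be the $\mathbb Q$-subspace of $\mathbb R$ spanned by all multiple zeta values (a $\mathbb Q$-algebra). For arbitrary positive integers $k_1,\dots,k_n$, $\zeta^{*}(k_1,\ldots,k_n)$ and $\zeta^{ш}(k_1,\ldots,k_n)$ denote the harmonic- and shuffle-regularized values in the sense of Ihara–Kaneko–Zagier (constant terms at $T=0$ of the regularization polynomials compatible with the harmonic (stuffle) product, resp. shuffle product, normalized by $\zeta^*(1)=\zeta^{ш}(1)=T$); they agree with $\zeta$ on convergent indices and $\zeta^*(\emptyset)=\zeta^{ш}(\emptyset)=1$. Define \[\zeta^{*}_{\mathcal F}(k_1,\ldots,k_n)=\sum_{i=0}^{n}(-1)^{k_1+\cdots+k_i}\zeta^{*}(k_i,\ldots,k_1)\,\zeta^{*}(k_{i+1},\ldots,k_n),\] and $\zeta^{ш}_{\mathcal F}$ analogously with $\zeta^{ш}$. It is known that $\zeta^{*}_{\mathcal F}(\mathbf k)-\zeta^{ш}_{\mathcal F}(\mathbf k)\in\zeta(2)\mathcal Z$. The finite real multiple zeta value $\zeta_{\mathcal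 F}(k_1,\ldots,k_n)$ is the class of $\zeta^{*}_{\mathcal F}(k_1,\ldots,k_n)$ in $\mathcal Z/\zeta(2)\mathcal Z$. *)

(* Defs.v *)
From HB Require Import structures.
From mathcomp Require Import all_boot all_order all_algebra.
From mathcomp Require Import all_classical all_reals all_analysis.
From mathcomp Require Import ring lra.
Import Order.TTheory GRing.Theory Num.Theory.
Import numFieldNormedType.Exports.

Set Implicit Arguments.
Unset Strict Implicit.
Unset Printing Implicit Defensive.

Local Open Scope classical_set_scope.
Local Open Scope ring_scope.

Definition index_pos (ks : seq nat) : bool := all (leq 1) ks.

(* The empty index is admissible, with zeta value 1. *)
Definition admissible (ks : seq nat) : bool :=
  index_pos ks && (if ks is k :: _ then (1 < k)%N else true).

(* mzv_trunc ks N is the sum of m_1^-k_1 ... m_n^-k_n over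
   N > m_1 > ... > m_n >= 1. *)
Fixpoint mzv_trunc (R : realType) (ks : seq nat) (N : nat) : R :=
  if ks is k :: ks' then
    \sum_(1 <= m < N) (m%:R ^- k * mzv_trunc R ks' m)
  else 1.

Definition mzv (R : realType) (ks : seq nat) : R :=
  lim (mzv_trunc R ks N @[N --> \oo]).

(* The terms, with multiplicity, of the harmonic product z_ks * z_ls. *)
Fixpoint stuffle (ks : seq nat) : seq nat -> seq (seq nat) :=
  if ks is k :: ks' then
    fix stuffle_ks (ls : seq nat) : seq (seq nat) :=
      if ls is l :: ls' then
        [seq k :: w | w <- stuffle ks' ls]
        ++ [seq l :: w | w <- stuffle_ks ls']
        ++ [seq (k + l)%N :: w | w <- stuffle ks' ls']
      else [:: ks]
  else fun ls => [:: ls].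

(* A harmonic-product homomorphism from the algebra on words z_k1 ... z_kn
   (all k_i >= 1) to R[T], given by its values on words, that extends zeta on
   admissible words and sends z_1 to T.  It exists, and its values on indices
   of positive integers are unique (see harmonic_regularization_exists and
   harmonic_regularization_unique); sequences with a zero entry are
   unconstrained and never used. *)
Definition harmonic_regularization (R : realType)
    (Z : seq nat -> {poly R}) : Prop :=
  [/\ forall ks, admissible ks -> Z ks = (mzv R ks)%:P,
      Z [:: 1%N] = 'X
    & forall ks ls, index_pos ks -> index_pos ls ->
        Z ks * Z ls = \sum_(w <- stuffle ks ls) Z w].

(* Existence is proved by comparing truncated sums with polynomials in the
   harmonic numbers, up to errors decaying faster than any power of them. *)
Section HarmonicRegularization.
Variable R : realType.
Implicit Types (ks ls : seq nat) (N : nat) (P Q : {poly R}).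
Local Notation tr := (mzv_trunc R).

Lemma mzv_truncS k ks N : (0 < N)%N ->
  tr (k :: ks) N.+1 = tr (k :: ks) N + (N%:R^-1) ^+ k * tr ks N.
Proof. by move=> N0; rewrite /= big_nat_recr //= exprVn. Qed.

Lemma mzv_trunc_nil N : tr [::] N = 1. Proof. by []. Qed.

Lemma mzv_trunc_le1 k ks N : (N <= 1)%N -> tr (k :: ks) N = 0.
Proof. by move=> N1 /=; rewrite big_geq. Qed.

Lemma mzv_trunc_ge0 ks N : 0 <= tr ks N.
Proof.
elim: ks N => [|k ks IH] N //=.
by apply: sumr_ge0 => m _; rewrite mulr_ge0 // invr_ge0 exprn_ge0.
Qed.

Local Opaque mzv_trunc.

Lemma mzv_trunc_stuffle ks ls N :
  tr ks N * tr ls N = \sum_(w <- stuffle ks ls) tr w N.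
Proof.
elim: N ks ls => [|N IH] [|a s] [|b t];
  rewrite ?big_seq1 ?mzv_trunc_nil ?mul1r ?mulr1 //.
  rewrite mzv_trunc_le1 // mul0r /= !big_cat !big_map /= !big1 ?addr0 // => *;
  by rewrite mzv_trunc_le1.
case: N IH => [|N] IH.
  rewrite mzv_trunc_le1 // mul0r /= !big_cat !big_map /= !big1 ?addr0 // => *;
  by rewrite mzv_trunc_le1.
have := IH (a :: s) (b :: t).
have E1 := IH s (b :: t). have E2 := IH (a :: s) t. have E3 := IH s t.
rewrite !(@mzv_truncS _ _ N.+1) // [stuffle (a :: s) (b :: t)]/=.
rewrite -/(stuffle (a :: s) t) !big_cat !big_map /=.
under [in X in _ -> _ = X + _]eq_bigr do rewrite (@mzv_truncS _ _ N.+1) //.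
under [in X in _ -> _ = _ + (X + _)]eq_bigr do
  rewrite (@mzv_truncS _ _ N.+1) //.
under [in X in _ -> _ = _ + (_ + X)]eq_bigr do
  rewrite (@mzv_truncS _ _ N.+1) //.
rewrite !big_split /= -!big_distrr /= -E1 -E2 -E3 exprD /= => H.
set AA := tr (a :: s) N.+1 in H *; set BB := tr (b :: t) N.+1 in H *.
set A := tr s _; set B := tr t _; set x := _^-1.
transitivity (AA * BB + x ^+ a * (A * BB) + x ^+ b * (AA * B)
  + x ^+ a * x ^+ b * (A * B)); first by ring.
by rewrite H; ring.
Qed.

Let h N : R := tr [:: 1%N] N.

Let hS N : h N.+2 = h N.+1 + N.+1%:R^-1.
Proof. by rewrite /h mzv_truncS // mzv_trunc_nil mulr1 expr1. Qed.

Let h1 : h 1 = 0. Proof. exact: mzv_trunc_le1. Qed.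
Let h0 : h 0 = 0. Proof. exact: mzv_trunc_le1. Qed.

Let h_ge0 N : 0 <= h N. Proof. exact: mzv_trunc_ge0. Qed.

Let h_nd : nondecreasing_seq h.
Proof.
apply/nondecreasing_seqP => -[|N]; first by rewrite h0 h1.
by rewrite hS lerDl invr_ge0.
Qed.

Let h_gt0 N : (1 < N)%N -> 0 < h N.
Proof.
move=> N1; apply: lt_le_trans (h_nd N1).
by rewrite hS h1 add0r invr_gt0.
Qed.

Let h_harmonic N : h N.+1 = series (@harmonic R) N.
Proof.
by elim: N => [|N IH]; rewrite ?seriesEnat /= ?big_nil ?h1 ?big_nat_recr // hS IH seriesEnat.
Qed.

Let h_pinfty : h @ \oo --> +oo.
Proof.
apply: nondecreasing_dvgn_lt => // -/cvg_ex[l hl].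
apply: (@dvg_harmonic R); apply/cvg_ex; exists l.
rewrite -(_ : (fun N => h N.+1) = series harmonic); last by apply/funext => N.
by move: hl; rewrite -cvg_shiftS.
Qed.

Let exph N : expR (h N.+2) <= expR 1 * N.+1%:R.
Proof.
elim: N => [|N IH]; first by rewrite hS h1 add0r invr1 mulr1.
rewrite hS expRD.
have E : expR (N.+2%:R^-1) * N.+1%:R <= N.+2%:R :> R.
  rewrite [leRHS](_ : _ = expR (N.+2%:R^-1) * (N.+2%:R * expR (- N.+2%:R^-1))); last first.
    by rewrite mulrCA expRxMexpNx_1 mulr1.
  apply: ler_wpM2l; rewrite ?expR_ge0 //.
  apply: le_trans (_ : N.+2%:R * (1 - N.+2%:R^-1) <= _).
    by rewrite mulrBr mulfV // mulr1 -[N.+2%:R]natr1 addrK.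
  by rewrite ler_pM2l // expR_ge1Dx.
apply: (@le_trans _ _ (expR 1 * N.+1%:R * expR N.+2%:R^-1)).
  by rewrite ler_wpM2r // expR_ge0.
by rewrite -mulrA ler_wpM2l ?expR_ge0 // mulrC.
Qed.

Let g N : R := expR (- (h N / 2)).

Let g_ge0 N : 0 <= g N. Proof. exact: expR_ge0. Qed.

Let hX_le j : exists2 C : R, 0 <= C & forall N, h N ^+ j.+1 * g N <= C.
Proof.
exists (2 ^+ j.+1 * (j.+1)`!%:R); first by rewrite mulr_ge0 // exprn_ge0.
move=> N; rewrite /g expRN ler_pdivrMr ?expR_gt0 //.
have := @expR_ge1Dxn R (h N / 2) j; rewrite divr_ge0 // => /(_ isT) H.
have {}H := le_trans (ler_wpDl ler01 (lexx _)) H.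
rewrite ler_pdivrMr ?ltr0n ?fact_gt0 // expr_div_n ler_pdivrMr ?exprn_gt0 // in H.
by apply: le_trans H _; rewrite le_eqVlt; apply/orP; left; apply/eqP; ring.
Qed.

Let small (e : nat -> R) := forall j, h N ^+ j * e N @[N --> \oo] --> 0.

Let small_bound e (K : R) :
  (forall N, (0 < N)%N -> `|e N| <= K * g N) -> small e.
Proof.
move=> eK j.
have K0 : 0 <= K.
  have := le_trans (normr_ge0 _) (eK 1%N isT).
  by rewrite pmulr_lge0 // expR_gt0.
have [C C0 HC] := hX_le j.
apply/norm_cvg0P.
apply: (@squeeze_cvgr _ _ _ _ (cst 0) (fun N => K * C * (h N)^-1)).
- near=> N.
  have N1 : (1 < N)%N by near: N; exists 2%N.
  rewrite normr_ge0 /= normrM ger0_norm ?exprn_ge0 //.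
  rewrite ler_pdivlMr ?h_gt0 // mulrAC -exprSr.
  apply: (@le_trans _ _ (h N ^+ j.+1 * (K * g N))).
    by rewrite ler_wpM2l ?exprn_ge0 // eK // ltnW.
  by rewrite mulrCA ler_wpM2l.
- exact: cvg_cst.
- rewrite -[X in _ --> X](mulr0 (K * C)); apply: cvgMl_tmp.
  apply/gtr0_cvgV0 => //; near=> N; apply: h_gt0; near: N; by exists 2%N.
Unshelve. all: by end_near. Qed.

Let small_ext e e' : e =1 e' -> small e -> small e'.
Proof. by move=> /funext ->. Qed.

Let cvg_ext (u v : nat -> R) (l l' : R) : u =1 v -> l = l' ->
  u N @[N --> \oo] --> l -> v N @[N --> \oo] --> l'.
Proof. by move=> /funext -> ->. Qed.

Let small0 : small (fun=> 0).
Proof.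
by move=> j; apply: cvg_ext (cvg_cst (0 : R)) => // N; rewrite mulr0.
Qed.

Let smallD e e' : small e -> small e' -> small (fun N => e N + e' N).
Proof.
move=> He He' j; apply: cvg_ext (cvgD (He j) (He' j)); last exact: addr0.
by move=> N /=; rewrite mulrDr.
Qed.

Let smallZ (c : R) e : small e -> small (fun N => c * e N).
Proof.
move=> He j; apply: cvg_ext (cvgMl_tmp (He j)); last exact: mulr0.
by move=> N /=; rewrite mulrCA.
Qed.

Let smallMh e : small e -> small (fun N => h N * e N).
Proof.
by move=> He j; apply: cvg_ext (He j.+1) => // N; rewrite mulrA -exprSr.
Qed.

Let smallM e e' : small e -> small e' -> small (fun N => e N * e' N).
Proof.
move=> He He' j; apply: cvg_ext (cvgM (He j) (He' 0)); last exact: mulr0.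
by move=> N /=; rewrite expr0 mul1r mulrA.
Qed.

Let smallMp P e : small e -> small (fun N => P.[h N] * e N).
Proof.
move=> He; elim/poly_ind: P => [|P c IH].
  by apply: small_ext small0 => N; rewrite horner0 mul0r.
apply: small_ext (smallD (smallMh IH) (smallZ c He)) => N.
by rewrite /= hornerMXaddC; ring.
Qed.

Let small_sum (s : seq (seq nat)) (e : seq nat -> nat -> R) :
  (forall w, w \in s -> small (e w)) ->
  small (fun N => \sum_(w <- s) e w N).
Proof.
elim: s => [|w s IH] He.
  by apply: small_ext small0 => N; rewrite big_nil.
have Hw := He w (mem_head _ _).
have Hs : small (fun N => \sum_(v <- s) e v N).
  by apply: IH => v vs; apply: He; rewrite inE vs orbT.
by apply: small_ext (smallD Hw Hs) => N; rewrite big_cons.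
Qed.

Let cvg0_poly P : P.[h N] @[N --> \oo] --> 0 -> P = 0.
Proof.
have hV : (h N)^-1 @[N --> \oo] --> 0.
  apply/gtr0_cvgV0 => //; near=> N; apply: h_gt0; near: N; by exists 2%N.
elim/poly_ind: P => [|P c IH] // HP.
have P0 : P = 0.
  apply: IH.
  have H : (P * 'X + c%:P).[h N] * (h N)^-1 - c * (h N)^-1
      @[N --> \oo] --> (0 * 0 - c * 0).
    by apply: cvgB; [apply: cvgM | apply: cvgMl_tmp].
  rewrite !mulr0 subr0 in H.
  apply: cvg_trans H; apply: near_eq_cvg; near=> N.
  have hN : h N != 0.
    by rewrite gt_eqF // h_gt0 //; near: N; exists 2%N.
  rewrite /= hornerMXaddC; field; exact: hN.
move: HP; rewrite P0 mul0r add0r => HP.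
have Hc : c @[_ --> \oo] --> 0 by apply: cvg_ext HP => // N; rewrite hornerC.
have /cvg_lim := Hc; rewrite lim_cst // => -> //.
Unshelve. all: by end_near. Qed.

Let approx ks P := small (fun N => tr ks N - P.[h N]).

Let approx_unique ks P Q : approx ks P -> approx ks Q -> P = Q.
Proof.
move=> HP HQ; apply/eqP; rewrite -subr_eq0; apply/eqP/cvg0_poly.
have := smallD HQ (smallZ (-1) HP).
move=> /(_ 0); apply: cvg_trans; apply: near_eq_cvg; near=> N.
by rewrite /= hornerD hornerN; ring.
Unshelve. all: by end_near. Qed.

Let tr_le ks N : index_pos ks -> tr ks N <= h N ^+ size ks.
Proof.
elim: ks N => [|k ks IH] N /=; first by rewrite mzv_trunc_nil.
move=> /andP[k1 pks]; elim: N => [|N IHN].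
  by rewrite mzv_trunc_le1 // exprn_ge0.
case: N IHN => [|N] IHN; first by rewrite mzv_trunc_le1 // exprn_ge0.
rewrite mzv_truncS // hS exprS.
apply: (@le_trans _ _ (h N.+1 * h N.+1 ^+ size ks + N.+1%:R^-1 * h N.+1 ^+ size ks)).
  rewrite lerD // -?exprS //; apply: ler_pM; rewrite ?exprn_ge0 ?invr_ge0 ?mzv_trunc_ge0 //; last exact: IH.
  case: k k1 {IHN} => // k _; rewrite exprS ler_piMr ?invr_ge0 //.
  by rewrite exprn_ile1 ?invr_ge0 // invf_le1 // ler1n.
rewrite -mulrDl ler_wpM2l ?addr_ge0 ?invr_ge0 //.
by apply: lerXn2r; rewrite ?nnegrE ?addr_ge0 ?invr_ge0 ?lerDl ?invr_ge0.
Qed.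

Let g_step N : expR (- h N.+1) / N.+1%:R <= 4 * expR (- (h N.+1 / 2)) * (g N.+1 - g N.+2).
Proof.
have gS : g N.+2 = expR (- (h N.+1 / 2)) * expR (- (N.+1%:R^-1 / 2)).
  by rewrite -expRD -opprD -mulrDl -hS.
rewrite gS {1}/g.
rewrite (_ : expR (- h N.+1) = expR (- (h N.+1 / 2)) * expR (- (h N.+1 / 2))); last first.
  by rewrite -expRD -opprD -splitr.
set a := expR (- (h _ / 2)); have a0 : 0 <= a by exact: expR_ge0.
rewrite [leRHS](_ : _ = a * a * (4 * (1 - expR (- (N.+1%:R^-1 / 2))))); last by rewrite -/a; ring.
apply: ler_wpM2l; first by rewrite mulr_ge0.
set x : R := N.+1%:R^-1.
have x0 : 0 < x by rewrite invr_gt0.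
have x1 : x <= 1 by rewrite invf_le1 // ler1n.
have : expR (- (x / 2)) * (1 + x / 2) <= 1.
  rewrite -[leRHS](@expRxMexpNx_1 R (x / 2)) mulrC ler_wpM2r ?expR_ge0 //.
  exact: expR_ge1Dx.
set y := expR _ => H.
nra.
Qed.

Let tr_step k ks : (1 < k)%N -> index_pos ks -> exists2 K : R, 0 <= K &
  forall N, tr (k :: ks) N.+2 - tr (k :: ks) N.+1 <= K * (g N.+1 - g N.+2).
Proof.

move=> k1 pks.
have [C C0 HC] : exists2 C : R, 0 <= C & forall N, h N ^+ size ks * g N <= C.
  case: (size ks) => [|j]; last exact: hX_le.
  exists 1 => // N; rewrite expr0 mul1r /g expRN invf_le1 ?expR_gt0 //.
  by rewrite -expR0 ler_expR divr_ge0.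
exists (4 * (expR 1 * C)); first by rewrite !mulr_ge0 // expR_ge0.
move=> N; rewrite mzv_truncS // addrC addKr.
set x : R := N.+1%:R^-1.
have x0 : 0 <= x by rewrite invr_ge0.
have x1 : x <= 1 by rewrite invf_le1 // ler1n.
have xk : x ^+ k <= x * x.
  by rewrite -expr2; apply: ler_wiXn2l.
have xe : x <= expR 1 * expR (- h N.+1).
  rewrite expRN ler_pdivlMr ?expR_gt0 // ler_pdivrMl ?ltr0Sn // mulrC.
  by apply: le_trans (exph N); rewrite ler_expR h_nd.
have hC : h N.+1 ^+ size ks <= C * expR (h N.+1 / 2).
  by have := HC N.+1; rewrite /g expRN ler_pdivrMr ?expR_gt0.
have := g_step N; rewrite -/x => gs.
have xg : x * x <= expR 1 * (4 * expR (- (h N.+1 / 2)) * (g N.+1 - g N.+2)).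
  apply: le_trans (ler_wpM2l (expR_ge0 1) gs).
  by rewrite mulrA ler_wpM2r.
apply: (@le_trans _ _ (x * x * (C * expR (h N.+1 / 2)))).
  apply: ler_pM; rewrite ?exprn_ge0 ?mzv_trunc_ge0 //.
  exact: le_trans (tr_le _ pks) hC.
apply: le_trans (ler_wpM2r _ xg) _; first by rewrite mulr_ge0 ?expR_ge0.
rewrite le_eqVlt; apply/orP; left; apply/eqP.
rewrite (_ : expR (- (h N.+1 / 2)) = (expR (h N.+1 / 2))^-1) ?expRN //.
by field; rewrite gt_eqF ?expR_gt0.
Qed.

Let approx_admissible ks : admissible ks -> approx ks (mzv R ks)%:P.
Proof.
case: ks => [_|k ks /andP[/= /andP[_ pks] k1]].
  apply: small_ext small0 => N; rewrite hornerC mzv_trunc_nil /mzv.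
  by rewrite (_ : tr [::] = cst 1) ?lim_cst ?subrr //; apply/funext.
have [K K0 HK] := tr_step k1 pks.
pose u N := tr (k :: ks) N.+1.
have u_nd : nondecreasing_seq u.
  apply/nondecreasing_seqP => N; rewrite /u (@mzv_truncS _ _ N.+1) // lerDl.
  by rewrite mulr_ge0 ?mzv_trunc_ge0 // exprn_ge0 // invr_ge0.
have ug M N : (N <= M)%N -> u M + K * g M.+1 <= u N + K * g N.+1.
  elim: M => [|M IH]; first by rewrite leqn0 => /eqP ->.
  rewrite leq_eqVlt => /orP[/eqP -> //|]; rewrite ltnS => /IH.
  apply: le_trans; have := HK M; rewrite /u; lra.
have ub M N : (N <= M)%N -> u M <= u N + K * g N.+1.
  by move=> /ug; apply: le_trans; rewrite lerDl mulr_ge0.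
have cu : cvgn u.
  apply: nondecreasing_is_cvgn => //; exists (u 0%N + K * g 1) => _ [n _ <-].
  exact: ub.
have Lu : limn u = mzv R (k :: ks).
  apply/esym/cvg_lim => //.
  by rewrite -cvg_shiftS; exact: cu.
apply: (@small_bound _ K) => -[//|N] _.
rewrite hornerC -Lu distrC ger0_norm ?subr_ge0; last first.
  exact: (nondecreasing_cvgn_le u_nd cu N).
rewrite lerBlDl; apply: limr_le => //.
by near=> M; apply: ub; near: M; exists N.
Unshelve. all: by end_near. Qed.

Fixpoint lead1 ks : nat :=
  if ks is k :: ks' then if k == 1%N then (lead1 ks').+1 else 0%N else 0%N.

Lemma stuffle_pos ks ls : index_pos ks -> index_pos ls ->
  all index_pos (stuffle ks ls).
Proof.
elim: ks ls => [|k ks IHk] ls; first by move=> _ /= ->.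
elim: ls => [|l ls IHl] pk pl; first by rewrite /= andbT.
move: (pk) (pl) => /= /andP[k0 pks] /andP[l0 pls].
rewrite -/(stuffle (k :: ks) ls) !all_cat !all_map.
apply/and3P; split; apply/allP => w wI /=.
- by rewrite k0 (allP (IHk _ pks pl)).
- by rewrite l0 (allP (IHl pk pls)).
- by rewrite addn_gt0 k0 (allP (IHk _ pks pls)).
Qed.

Lemma stuffle1 ls : index_pos ls -> exists2 s : seq (seq nat),
  all (fun w => index_pos w && (lead1 w <= lead1 ls)%N) s &
  forall (A : pzRingType) (F : seq nat -> A), \sum_(w <- stuffle [:: 1%N] ls) F w =
    (lead1 ls).+1%:R * F (1%N :: ls) + \sum_(w <- s) F w.
Proof.
elim: ls => [_|l ls IH] /=.
  by exists [::] => // A F; rewrite big_nil addr0 big_seq1 mul1r.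
rewrite -/(stuffle [:: 1%N] ls) => /andP[l0 pls].
have [->|l1] := eqVneq l 1%N.
  have [s /allP s1 sF] := IH pls.
  exists ([seq 1%N :: w | w <- s] ++ [:: (2 :: ls)%N]).
    rewrite all_cat /= pls !andbT; apply/allP => _ /mapP[w /s1 /andP[pw lw] ->] /=.
    by rewrite pw ltnS.
  move=> A F; rewrite big_cons !big_cat !big_map big_seq1 /= (sF _ (F \o cons 1%N)) /=.
  by rewrite -[in RHS]natr1 mulrDl mul1r !addrA; congr (_ + _ + _); rewrite addrC.
exists ([seq l :: w | w <- stuffle [:: 1%N] ls] ++ [:: (1 + l)%N :: ls]).
  rewrite all_cat /= pls !andbT; apply/andP; split.
    apply/allP => _ /mapP[w wI ->] /=.
    by rewrite l0 (negbTE l1) (allP (@stuffle_pos [:: 1%N] ls isT pls)).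
  by case: l l0 {l1} => [|l] /=.
by move=> A F; rewrite big_cons !big_cat mul1r.
Qed.

Let approx_ex ks : index_pos ks -> exists P, approx ks P.
Proof.
move: {2}(lead1 ks) (leqnn (lead1 ks)) => m; elim: m ks => [|m IH] ks.
  move=> lk pk; exists (mzv R ks)%:P; apply: approx_admissible.
  rewrite /admissible pk /=; case: ks lk pk => //= -[|[|k]] ks //=.
case: ks => [|k ks lk].
  by move=> _ _; exists (mzv R [::])%:P; exact: approx_admissible.
have [k1|k1] := eqVneq k 1%N; last first.
  by apply: IH => /=; rewrite (negbTE k1).
move: lk; rewrite {}k1 /= ltnS => lk pk.
have [s /allP s1 sF] := stuffle1 pk.
have [P HP] := IH _ lk pk.
have sQ : exists Q : seq nat -> {poly R}, forall w, w \in s -> approx w (Q w).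
  have : forall w, exists Q, w \in s -> approx w Q.
    move=> w; have [ws|ws] := boolP (w \in s); last by exists 0.
    have /andP[pw lw] := s1 w ws.
    by have [Q HQ] := IH _ (leq_trans lw lk) pw; exists Q.
  by move=> H; have [f Hf] := choice H; exists f.
have {sQ}[Q HQ] := sQ.
pose c : R := (lead1 ks).+1%:R.
exists (c^-1 *: ('X * P - \sum_(w <- s) Q w)).
have sm := small_sum HQ.
apply: small_ext (smallZ c^-1 (smallD (smallMh HP) (smallZ (-1) sm))) => N.
rewrite big_split /= sumrN.
have := mzv_trunc_stuffle [:: 1%N] ks N; rewrite sF -/(h N) -/c => E.
rewrite hornerZ hornerD hornerN hornerM hornerX horner_sum.
have c0 : c != 0 by rewrite pnatr_eq0.
have -> : tr (1%N :: ks) N = c^-1 * (h N * tr ks N - \sum_(w <- s) tr w N).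
  by rewrite E addrK mulKf.
ring.
Qed.

Lemma harmonic_regularization_exists :
  exists Z : seq nat -> {poly R}, harmonic_regularization Z.
Proof.
have : forall ks, exists P, index_pos ks -> approx ks P.
  move=> ks; have [pk|_] := boolP (index_pos ks); last by exists 0.
  by have [P HP] := approx_ex pk; exists P.
move=> /choice[Z HZ]; exists Z; split.
- move=> ks ak; apply: approx_unique (HZ _ _) (approx_admissible ak).
  by case/andP: ak.
- apply: approx_unique (HZ _ _) _ => //.
  by apply: small_ext small0 => N; rewrite hornerX subrr.
- move=> ks ls pk pl; apply/eqP; rewrite -subr_eq0; apply/eqP/cvg0_poly.
  have sk := HZ _ pk; have sl := HZ _ pl.
  have ss := small_sum (fun w ws => HZ w (allP (stuffle_pos pk pl) w ws)).
  have := smallD ss (smallZ (-1) (smallD (smallM sk sl)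
    (smallD (smallMp (Z ks) sl) (smallMp (Z ls) sk)))).
  move=> /(_ 0); apply: cvg_trans; apply: near_eq_cvg; near=> N.
  rewrite big_split /= sumrN -mzv_trunc_stuffle.
  rewrite hornerD hornerN hornerM horner_sum; ring.
Unshelve. all: by end_near. Qed.

Lemma harmonic_regularization_unique (Z Z' : seq nat -> {poly R}) ks :
  harmonic_regularization Z -> harmonic_regularization Z' ->
  index_pos ks -> Z ks = Z' ks.
Proof.
move=> [Za Z1 ZM] [Za' Z1' ZM'].
move: {2}(lead1 ks) (leqnn (lead1 ks)) => m; elim: m ks => [|m IH] ks.
  move=> lk pk; rewrite Za ?Za' //; rewrite /admissible pk /=;
  by case: ks lk pk => //= -[|[|k]] ks.
case: ks => [|k ks lk]; first by move=> _ _; rewrite Za ?Za'.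
have [k1|k1] := eqVneq k 1%N; last first.
  by apply: IH => /=; rewrite (negbTE k1).
move: lk; rewrite {}k1 /= ltnS => lk pk.
have [s /allP s1 sF] := stuffle1 pk.
have E := ZM [:: 1%N] ks isT pk; have E' := ZM' [:: 1%N] ks isT pk.
rewrite sF Z1 in E; rewrite sF Z1' -IH // in E'.
have ss : \sum_(w <- s) Z w = \sum_(w <- s) Z' w.
  apply: eq_big_seq => w /s1 /andP[pw lw].
  by apply: IH => //; exact: leq_trans lw lk.
rewrite E ss in E'; move/addIr: E'; rewrite -polyC_natr; apply: mulfI.
by rewrite polyC_eq0 pnatr_eq0.
Qed.

End HarmonicRegularization.

Definition zeta_star_poly (R : realType) : seq nat -> {poly R} :=
  sval (cid (harmonic_regularization_exists R)).

Definition zeta_star (R : realType) (ks : seq nat) : R :=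
  (zeta_star_poly R ks).[0].

Definition zeta_star_F (R : realType) (ks : seq nat) : R :=
  \sum_(i < (size ks).+1)
    (-1) ^+ sumn (take i ks)
    * zeta_star R (rev (take i ks)) * zeta_star R (drop i ks).

Definition mzv_span (R : realType) : set R :=
  [set x | exists2 s : seq (rat * seq nat),
     all (fun p => admissible p.2) s &
     x = \sum_(p <- s) ratr p.1 * mzv R p.2].
Arguments mzv_span : clear implicits.

Section MzvSpan.
Variable R : realType.
Implicit Types (ks ls : seq nat) (x y : R).

Lemma zeta_star_polyP : harmonic_regularization (zeta_star_poly R).
Proof. exact: svalP (cid (harmonic_regularization_exists R)). Qed.

Lemma mzv_span_mzv ks : admissible ks -> mzv_span R (mzv R ks).
Proof.
move=> ak; exists [:: (1, ks)]; first by rewrite /= ak.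
by rewrite big_seq1 rmorph1 mul1r.
Qed.

Lemma mzv_span0 : mzv_span R 0.
Proof. by exists [::]; rewrite ?big_nil. Qed.

Lemma mzv_spanD x y : mzv_span R x -> mzv_span R y -> mzv_span R (x + y).
Proof.
move=> [s sa ->] [t ta ->]; exists (s ++ t); first by rewrite all_cat sa.
by rewrite big_cat.
Qed.

Lemma mzv_spanZ (a : rat) x : mzv_span R x -> mzv_span R (ratr a * x).
Proof.
move=> [s sa ->]; exists [seq (a * p.1, p.2) | p <- s].
  by rewrite all_map; apply: sub_all sa.
by rewrite big_map mulr_sumr; apply: eq_bigr => p _; rewrite rmorphM mulrA.
Qed.

Lemma mzv_span_sum (I : eqType) (s : seq I) (F : I -> R) :
  (forall i, i \in s -> mzv_span R (F i)) ->
  mzv_span R (\sum_(i <- s) F i).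
Proof.
move=> HF; rewrite big_seq; apply: (big_ind (mzv_span R)) => //.
- exact: mzv_span0.
- exact: mzv_spanD.
Qed.

Lemma stuffle_admissible ks ls : admissible ks -> admissible ls ->
  all admissible (stuffle ks ls).
Proof.
move=> ak al; have /andP[pk _] := ak; have /andP[pl _] := al.
apply/allP => w wI; rewrite /admissible (allP (stuffle_pos pk pl) _ wI) /=.
case: ks ls ak al wI {pk pl} => [|k ks] [|l ls] /=.
- by rewrite inE => _ _ /eqP ->.
- by rewrite inE => _ /andP[_ l1] /eqP ->.
- by rewrite inE => /andP[_ k1] _ /eqP ->.
rewrite !mem_cat => /andP[_ k1] /andP[_ l1].
case/or3P => /mapP[v _ ->] //.
by rewrite (leq_trans k1) // leq_addr.
Qed.

Lemma mzvM ks ls : admissible ks -> admissible ls ->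
  mzv R ks * mzv R ls = \sum_(w <- stuffle ks ls) mzv R w.
Proof.
move=> ak al; have [Za _ ZM] := zeta_star_polyP; apply: polyC_inj.
have /andP[pk _] := ak; have /andP[pl _] := al.
rewrite polyCM -Za // -(Za ls) // ZM // rmorph_sum /=.
by apply: eq_big_seq => w /(allP (stuffle_admissible ak al)) /Za.
Qed.

Lemma mzv_spanM x y : mzv_span R x -> mzv_span R y -> mzv_span R (x * y).
Proof.
move=> [s sa ->] [t ta ->]; rewrite mulr_suml; apply: mzv_span_sum => p ps.
rewrite mulr_sumr; apply: mzv_span_sum => q qt.
rewrite mulrACA -rmorphM; apply: mzv_spanZ.
have ap := allP sa _ ps; have aq := allP ta _ qt.
rewrite mzvM //; apply: mzv_span_sum => w ws; apply: mzv_span_mzv.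
exact: (allP (stuffle_admissible ap aq)).
Qed.

Lemma mzv_span_zeta_star ks : index_pos ks -> mzv_span R (zeta_star R ks).
Proof.
have [Za Z1 ZM] := zeta_star_polyP.
move: {2}(lead1 ks) (leqnn (lead1 ks)) => m; elim: m ks => [|m IH] ks.
  move=> lk pk; have ak : admissible ks.
    rewrite /admissible pk /=.
    by case: ks lk pk => //= -[|[|k]] ks.
  by rewrite /zeta_star Za // hornerC; exact: mzv_span_mzv.
case: ks => [|k ks lk].
  by move=> _ _; rewrite /zeta_star Za // hornerC; exact: mzv_span_mzv.
have [k1|k1] := eqVneq k 1%N; last first.
  by apply: IH => /=; rewrite (negbTE k1).
move: lk; rewrite {}k1 /= ltnS => lk pk.
have [s /allP s1 sF] := stuffle1 pk.
have := ZM [:: 1%N] ks isT pk; rewrite sF Z1 => /(congr1 (horner^~ 0)).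
rewrite hornerM hornerX mul0r hornerD -polyC_natr hornerM hornerC horner_sum.
rewrite -/(zeta_star R (1%N :: ks)) => E.
set c : R := _%:R in E; have c0 : c != 0 by rewrite pnatr_eq0.
have -> : zeta_star R (1%N :: ks) =
    ratr (- (lead1 ks).+1%:R^-1) * \sum_(w <- s) (zeta_star_poly R w).[0].
  rewrite rmorphN fmorphV rmorph_nat -/c; apply: (mulfI c0).
  rewrite mulNr mulrN mulVKf //; apply/eqP; rewrite -addr_eq0.
  by rewrite -E.
apply: mzv_spanZ; apply: mzv_span_sum => w /s1 /andP[pw lw].
by apply: IH => //; exact: leq_trans lw lk.
Qed.

Lemma mzv_span_zeta_star_F ks :
  index_pos ks -> mzv_span R (zeta_star_F R ks).
Proof.
move=> pk; apply: mzv_span_sum => i _.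
have := pk; rewrite -{1}(cat_take_drop i ks) /index_pos all_cat.
move=> /andP[pt pd].
have -> : (-1) ^+ sumn (take i ks) = ratr ((-1) ^+ sumn (take i ks)) :> R.
  by rewrite rmorphXn rmorphN1.
rewrite -mulrA; apply: mzv_spanZ; apply: mzv_spanM.
  by apply: mzv_span_zeta_star; rewrite /index_pos all_rev.
exact: mzv_span_zeta_star.
Qed.

End MzvSpan.

Definition zeta2_ideal (R : realType) : set R :=
  [set mzv R [:: 2%N] * z | z in mzv_span R].
Arguments zeta2_ideal : clear implicits.

(* The residue class in Z / zeta(2) Z, as a coset; zeta_star_F takes its values
   in Z by mzv_span_zeta_star_F. *)
Definition zeta_F (R : realType) (ks : seq nat) : set R :=
  [set zeta_star_F R ks + y | y in zeta2_ideal R].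
Arguments zeta_F : clear implicits.

(* Main.v *)
(* Let E(t) be the generating function of the words z_1^i.  Multiplying the
   reversed part of zeta_F by E(t) in the harmonic algebra makes all divergent
   words cancel in pairs (E(-t) * E(t) only involves z_2), and since the values zeta(2, ..., 2) lie in zeta(2) Z one gets
     zeta_F(k, 1^(n-1)) = zeta(k, 1^(n-1)) + (-1)^k zeta^star(k, 1^(n-1))
   modulo zeta(2).  A Tornheim-type double series and partial fractions express
   the star value through the sums
     \sum_l e_(n-2)(1, ..., 1/(l-1)) H_l / l^k
   and products zeta(r) zeta(k+1-r, 1^(n-2)).  Up to even zeta values, which lie
   in zeta(2) Z by Euler, the result is symmetric in k and n: the height one
   duality and the remaining symmetry both come from expanding in a symmetric
   kernel, 1 / binomial(m + a, a) for the former and [kern] for the latter. *)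

Require Import Defs.
From mathcomp Require Import all_boot all_order all_algebra.
From mathcomp Require Import all_classical all_reals all_analysis.
From mathcomp Require Import ring lra zify.
Import Order.TTheory GRing.Theory Num.Theory.
Import numFieldNormedType.Exports.

Set Implicit Arguments.
Unset Strict Implicit.
Unset Printing Implicit Defensive.

Local Open Scope classical_set_scope.
Local Open Scope ring_scope.

(** * Series of nonnegative terms *)

Section PositiveSeries.
Variable R : realType.
Implicit Types (f g u : nat -> R) (S T : R).

Definition sums f S := \sum_(i < n) f i @[n --> \oo] --> S.

Lemma sums_ext f g S T : f =1 g -> S = T -> sums f S -> sums g T.
Proof. by move=> /funext -> ->. Qed.

Lemma sums_unique f S T : sums f S -> sums f T -> S = T.
Proof. exact: cvg_unique. Qed.

Lemma sumsD f g S T : sums f S -> sums g T -> sums (fun i => f i + g i) (S + T).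
Proof.
move=> fS gT; rewrite /sums.
under eq_fun do rewrite big_split.
exact: cvgD.
Qed.

Lemma sumsZ (c : R) f S : sums f S -> sums (fun i => c * f i) (c * S).
Proof.
move=> fS; rewrite /sums.
under eq_fun do rewrite -mulr_sumr.
exact: cvgMl_tmp.
Qed.

Arguments sumsZ : clear implicits.

Lemma sumsB f g S T : sums f S -> sums g T -> sums (fun i => f i - g i) (S - T).
Proof.
move=> fS /(sumsZ (-1) _ _) /(sumsD fS).
by apply: sums_ext => [i|]; rewrite mulN1r.
Qed.

Lemma sums0 : sums (fun=> 0) 0.
Proof.
rewrite /sums; under eq_fun do rewrite big1 //.
exact: cvg_cst.
Qed.

Lemma sums_sum (I : eqType) (s : seq I) (F : I -> nat -> R) (S : I -> R) :
  (forall i, i \in s -> sums (F i) (S i)) ->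
  sums (fun n => \sum_(i <- s) F i n) (\sum_(i <- s) S i).
Proof.
elim: s => [|i s IH] FS.
  by apply: sums_ext sums0 => [n|]; rewrite big_nil.
have FSs : forall j, j \in s -> sums (F j) (S j).
  by move=> j js; apply: FS; rewrite inE js orbT.
apply: sums_ext (sumsD (FS i (mem_head _ _)) (IH FSs)) => [n|];
by rewrite big_cons.
Qed.

Lemma sums_ord N (F : 'I_N -> nat -> R) (S : 'I_N -> R) :
  (forall i, sums (F i) (S i)) ->
  sums (fun n => \sum_(i < N) F i n) (\sum_(i < N) S i).
Proof. by move=> FS; apply: sums_sum. Qed.

Lemma sums_finite f N : (forall i, (N <= i)%N -> f i = 0) ->
  sums f (\sum_(i < N) f i).
Proof.
move=> f0; apply: cvg_near_cst; near=> n.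
have nN : (N <= n)%N by near: n; exists N.
rewrite -(subnK nN) addnC; elim: (n - N)%N => [|d IH]; first by rewrite addn0.
by rewrite addnS big_ord_recr /= IH f0 ?addr0 // leq_addr.
Unshelve. all: by end_near. Qed.

Lemma sums_recl f S : sums (fun i => f i.+1) S -> sums f (f 0%N + S).
Proof.
move=> fS; rewrite /sums -cvg_shiftS /=.
have E n : \sum_(i < n.+1) f i = f 0%N + \sum_(i < n) f i.+1.
  by rewrite big_ord_recl.
rewrite (funext E); apply: cvgD fS; exact: cvg_cst.
Qed.

Lemma sums_shift f N S : sums (fun i => f (N + i)%N) S ->
  sums (fun i => if (i < N)%N then 0 else f i) S.
Proof.
elim: N f => [|N IH] f fS; first by apply: sums_ext fS.
apply: sums_ext (sums_recl (f := fun i => if (i < N.+1)%N then 0 else f i)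
  (IH (f \o succn) _)) => //=; first by rewrite add0r.
Qed.

Lemma psum_nd f : (forall i, 0 <= f i) ->
  nondecreasing_seq (fun n => \sum_(i < n) f i).
Proof.
by move=> f0; apply/nondecreasing_seqP => n; rewrite big_ord_recr lerDl.
Qed.

Lemma sums_ge f S n : (forall i, 0 <= f i) -> sums f S -> \sum_(i < n) f i <= S.
Proof.
move=> f0 fS; have <- := cvg_lim (@Rhausdorff R) fS.
by apply: (nondecreasing_cvgn_le (psum_nd f0)); apply/cvg_ex; exists S.
Qed.

Lemma sums_bounded f M : (forall i, 0 <= f i) ->
  (forall n, \sum_(i < n) f i <= M) -> exists2 S, sums f S & S <= M.
Proof.
move=> f0 fM; have cf : cvgn (fun n => \sum_(i < n) f i).
  by apply: nondecreasing_is_cvgn; [exact: psum_nd|exists M => _ [n _ <-]].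
exists (limn (fun n => \sum_(i < n) f i)) => //.
by apply: limr_le => //; near=> n.
Unshelve. all: by end_near. Qed.

Lemma sums_dominated f g S : (forall i, 0 <= f i <= g i) -> sums g S ->
  exists T, sums f T.
Proof.
move=> fg gS; have f0 i : 0 <= f i by case/andP: (fg i).
have g0 i : 0 <= g i by case/andP: (fg i) => /le_trans; apply.
have [n|T fT _] := @sums_bounded f S f0; last by exists T.
by apply: le_trans (sums_ge n g0 gS); apply: ler_sum => i _; case/andP: (fg i).
Qed.

Lemma sums_le f g S T : (forall i, f i <= g i) -> sums f S -> sums g T -> S <= T.
Proof.
move=> fg fS gT; apply: (ler_cvg_to fS gT).
by near=> n; apply: ler_sum.
Unshelve. all: by end_near. Qed.

(** Tonelli's theorem, with convergence of [c] as part of the conclusion. Finitely many columns are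
    bounded by the total over the rows, which gives convergence and one inequality ([half]); the
    transpose gives the other. *)
Lemma sums_exchange (f : nat -> nat -> R) (r c : nat -> R) S :
  (forall i j, 0 <= f i j) -> (forall i, sums (f i) (r i)) ->
  (forall j, sums (fun i => f i j) (c j)) -> sums r S -> sums c S.
Proof.
have half (F : nat -> nat -> R) (p q : nat -> R) T : (forall i j, 0 <= F i j) ->
    (forall i, sums (F i) (p i)) -> (forall j, sums (fun i => F i j) (q j)) ->
    sums p T -> exists2 T', sums q T' & T' <= T.
  move=> F0 Fp Fq pT; apply: sums_bounded => [j|n].
    by have := sums_ge 0 (F0 ^~ j) (Fq j); rewrite big_ord0.
  apply: (@sums_le (fun i => \sum_(j < n) F i j) p) pT; last exact: sums_ord.
  by move=> i; apply: sums_ge.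
move=> f0 fr fc rS; have [T cT TS] := half f r c S f0 fr fc rS.
have [S' rS' S'T] := half (fun j i => f i j) c r T (fun j i => f0 i j) fc fr cT.
rewrite (sums_unique rS rS') in TS *.
by have -> : S' = T by apply/le_anti; rewrite S'T TS.
Qed.

(** [G i] is the tail of [g] beyond [i], so both series sum [f i * g j] over [i < j], once by rows
    and once by columns. *)
Lemma sums_triangle f g (G : nat -> R) S :
  (forall i, 0 <= f i) -> (forall j, 0 <= g j) ->
  (forall i, sums (fun j => g (i.+1 + j)%N) (G i)) ->
  sums (fun i => f i * G i) S ->
  sums (fun j => (\sum_(i < j) f i) * g j) S.
Proof.
move=> f0 g0 gG; pose F i j := f i * (if (j < i.+1)%N then 0 else g j).
apply: (@sums_exchange F).
- by move=> i j; rewrite /F; case: ifP; rewrite ?mulr0 ?mulr_ge0.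
- by move=> i; apply: (sumsZ (f i)); apply: sums_shift.
move=> j; apply: sums_ext (@sums_finite (F ^~ j) j _) => //.
  rewrite mulr_suml; apply: eq_bigr => -[i ij] _ /=.
  by rewrite /F ltnS leqNgt ij.
by move=> i ji; rewrite /F ltnS ji mulr0.
Qed.

Lemma sums_telescope u : u n @[n --> \oo] --> (0 : R) ->
  sums (fun i => u i - u i.+1) (u 0%N).
Proof.
move=> u0; have E n : \sum_(i < n) (u i - u i.+1) = u 0%N - u n.
  elim: n => [|n IH]; first by rewrite big_ord0 subrr.
  by rewrite big_ord_recr /= IH addrA subrK.
rewrite /sums (funext E) -[X in _ --> X]subr0.
by apply: cvgB => //; exact: cvg_cst.
Qed.

Lemma cvg_shiftn u (l : R) N : u n @[n --> \oo] --> l ->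
  u (N + n)%N @[n --> \oo] --> l.
Proof.
move=> ul; elim: N => [|N IH] //.
have := IH; rewrite -cvg_shiftS /=.
by under eq_fun do rewrite addnS -addSn.
Qed.

Lemma sums_telescope_from u N : u n @[n --> \oo] --> (0 : R) ->
  sums (fun i => u (N + i)%N - u (N + i).+1) (u N).
Proof.
move=> u0; have := sums_telescope (cvg_shiftn N u0).
by apply: sums_ext => [i|]; rewrite ?addn0 ?addnS.
Qed.

Lemma cvg_cst_seq (c : R) : (fun=> c) @ \oo --> c.
Proof. exact: cvg_cst. Qed.

Lemma squeeze0 u f : (forall n, 0 <= u n <= f n) ->
  f n @[n --> \oo] --> (0 : R) -> u n @[n --> \oo] --> (0 : R).
Proof.
move=> uf f0.
have c0 : (fun _ : nat => 0 : R) @ \oo --> (0 : R) by exact: cvg_cst.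
apply: (squeeze_cvgr _ c0 f0).
by near=> n; exact: uf.
Unshelve. all: by end_near. Qed.

Lemma cvg_inv_nat : (n.+1%:R^-1 : R) @[n --> \oo] --> (0 : R).
Proof. exact: cvg_harmonic. Qed.

End PositiveSeries.
Arguments sumsZ {R} c {f S}.
Arguments sums_telescope_from {R u} N.
Arguments cvg_cst_seq {R} c t _.
Arguments cvg_shiftn {R u l} N _ t _.

(** * Convergence and duality for zeta(k, 1, ..., 1) *)

Section HeightOneDuality.
Variable R : realType.
Implicit Types (i j k m n : nat) (ks w : seq nat).
Local Notation tr := (mzv_trunc R).

Definition xinv i : R := i.+1%:R^-1.
Local Notation x := xinv.

Lemma xinv_gt0 i : 0 < x i. Proof. by rewrite invr_gt0. Qed.
Lemma xinv_ge0 i : 0 <= x i. Proof. exact/ltW/xinv_gt0. Qed.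
Lemma xinv_le1 i : x i <= 1. Proof. by rewrite invf_le1 // ler1n. Qed.

Lemma mzv_truncE k ks n :
  tr (k :: ks) n.+1 = \sum_(i < n) x i ^+ k * tr ks i.+1.
Proof.
rewrite /= big_add1 /= big_mkord; apply: eq_bigr => i _.
by rewrite exprVn.
Qed.

Definition ones n : seq nat := nseq n 1%N.

(* [eps j i] is the coefficient of [t^(j+1)] in
   (t / l) (1 + t/1) ... (1 + t/(l-1)) at [l = i + 1]. *)
Definition eps j i : R := x i * tr (ones j) i.+1.

Lemma eps_ge0 j i : 0 <= eps j i.
Proof. by rewrite mulr_ge0 ?xinv_ge0 ?mzv_trunc_ge0. Qed.

Lemma epsS j i : eps j.+1 i = (\sum_(l < i) eps j l) * x i.
Proof. by rewrite /eps mzv_truncE mulrC. Qed.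

Lemma eps0 i : eps 0 i = x i. Proof. by rewrite /eps mulr1. Qed.

(** * The reciprocal binomial kernel and duality in height one *)

Definition invbin m a : R := 'C(m + a, a)%:R^-1.

Lemma invbin_ge0 m a : 0 <= invbin m a. Proof. by rewrite invr_ge0. Qed.

Lemma invbinC m a : invbin m a = invbin a m.
Proof. by rewrite /invbin -bin_sub ?leq_addl // addnK addnC. Qed.

Lemma invbinS m a : (m + a).+1%:R * invbin m a.+1 = a.+1%:R * invbin m a.
Proof.
rewrite /invbin addnS; have /= E := mul_bin_diag (m + a).+1 a.
have B0 : 'C((m + a).+1, a.+1)%:R != 0 :> R.
  by rewrite pnatr_eq0 -lt0n bin_gt0 ltnS leq_addl.
have B1 : 'C(m + a, a)%:R != 0 :> R by rewrite pnatr_eq0 -lt0n bin_gt0 leq_addl.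
apply: (mulIf B0); apply: (mulIf B1); rewrite mulfVK // [RHS]mulrAC mulfVK //.
by rewrite -!natrM E.
Qed.

(** Rearranging [invbinS] turns the kernel weighted by 1/(a+1) into a difference in [a], so its
    tails have a closed form. *)
Lemma invbin_tele m a :
  invbin m.+1 a.+1 * x a = x m * (invbin m.+1 a - invbin m.+1 a.+1).
Proof.
have := invbinS m.+1 a; set B := invbin _ a.+1; set A := invbin _ a => E.
apply: (mulfI (_ : m.+1%:R * a.+1%:R != 0 :> R)); first by rewrite mulf_neq0 // pnatr_eq0.
rewrite /xinv; transitivity (m.+1%:R * B); first by field.
transitivity (a.+1%:R * (A - B)); last by field.
by rewrite mulrBr -E -addnS natrD; ring.
Qed.

Lemma invbin_m0 m : invbin m 0 = 1.
Proof. by rewrite /invbin addn0 bin0 invr1. Qed.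

Lemma cvg_div_nat (u : nat -> R) (c : R) m :
  u n @[n --> \oo] --> c -> u n / (m + n).+1%:R @[n --> \oo] --> (0 : R).
Proof.
move=> uc; rewrite -[X in _ --> X](mulr0 c); apply: cvgM => //.
exact: (cvg_shiftn (u := fun n => n.+1%:R^-1) m (@cvg_inv_nat R)).
Qed.

Lemma invbin_cvg0 m : invbin m.+1 a @[a --> \oo] --> (0 : R).
Proof.
apply: (@squeeze0 _ _ (fun a => m.+1%:R / (m + a).+1%:R)); last first.
  exact/cvg_div_nat/(cvg_cst_seq m.+1%:R).
move=> a; rewrite invbin_ge0 /= ler_pdivlMr ?ltr0Sn // mulrC invbinC.
rewrite addnC invbinS ler_piMr // /invbin invf_le1 ?ler1n ?ltr0n ?bin_gt0 leq_addl //.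
Qed.

(** By [epsS] the series is triangular, and telescoping replaces the tail beyond [a] by
    [x m * invbin m.+1 a.+1]; each increment of [k] thus brings out one factor [x m]. *)
Lemma sums_eps_invbin k m :
  sums (fun a => eps k a * invbin m.+1 a.+1) (x m ^+ k.+1).
Proof.
have tele N : sums (fun a => x (N + a)%N * invbin m.+1 (N + a).+1)
    (x m * invbin m.+1 N).
  have := sumsZ (x m) (sums_telescope_from N (@invbin_cvg0 m)).
  by apply: sums_ext => // a; rewrite -invbin_tele mulrC.
elim: k => [|k IH].
  apply: sums_ext (tele 0%N) => [a|]; first by rewrite eps0.
  by rewrite invbin_m0 mulr1.
have := @sums_triangle R (eps k) (fun a => x a * invbin m.+1 a.+1)
  (fun a => x m * invbin m.+1 a.+1) (x m ^+ k.+2).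
move=> H; apply: sums_ext (H _ _ _ _) => //.
- by move=> a; rewrite epsS mulrA.
- exact: eps_ge0.
- by move=> a; rewrite mulr_ge0 ?xinv_ge0 ?invbin_ge0.
- apply: sums_ext (sumsZ (x m) IH) => [a|]; last by rewrite -exprS.
  by rewrite mulrCA.
Qed.

(** Expand [x i ^+ k.+1] in the kernel, exchange the two sums, and resum over [i] using the symmetry
    [invbinC]. *)
Lemma sums_eps_dual j k S : sums (fun i => eps j i * x i ^+ k.+1) S ->
  sums (fun i => eps k i * x i ^+ j.+1) S.
Proof.
apply: (@sums_exchange _ (fun i a => eps j i * (eps k a * invbin i.+1 a.+1))).
- move=> i a; exact: mulr_ge0 (eps_ge0 _ _) (mulr_ge0 (eps_ge0 _ _) (invbin_ge0 _ _)).
- by move=> i; apply: (sumsZ (eps j i)); exact: sums_eps_invbin.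
- move=> a; apply: sums_ext (sumsZ (eps k a) (@sums_eps_invbin j a)) => //.
  by move=> i; rewrite invbinC mulrCA.
Qed.

Lemma sums_inv_sq : exists S, sums (fun i => x i ^+ 2) S.
Proof.
(* Since 1/l^2 <= 2/(l(l+1)), the bound is twice the telescoping series [sums_eps_invbin] at
   [k = m = 0]. *)
have [] := @sums_dominated R (fun i => x i ^+ 2)
  (fun i => 2 * (eps 0 i * invbin 1 i.+1)) (2 * x 0 ^+ 1).
- move=> i; rewrite exprn_ge0 ?xinv_ge0 //= eps0 expr2 mulrCA.
  rewrite ler_wpM2l ?xinv_ge0 // /invbin add1n binSn /xinv.
  rewrite -[X in X <= _]mul1r ler_pdivlMr ?ltr0Sn // mul1r ler_pdivrMl ?ltr0Sn //.
  by rewrite -natrM ler_nat; lia.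
- exact/sumsZ/sums_eps_invbin.
by move=> S xS; exists S.
Qed.

Lemma mzv_trunc_le_ones ks n : index_pos ks -> tr ks n.+1 <= tr (ones (size ks)) n.+1.
Proof.
elim: ks n => [|k ks IH] n // /andP[k0 pks].
have -> : ones (size (k :: ks)) = 1%N :: ones (size ks) by [].
rewrite !mzv_truncE; apply: ler_sum => i _.
apply: ler_pM; rewrite ?exprn_ge0 ?xinv_ge0 ?mzv_trunc_ge0 ?IH //.
by apply: ler_wiXn2l; rewrite ?xinv_ge0 ?xinv_le1.
Qed.

(** The tail of the index is bounded by a string of ones and the power by a square; duality moves
    the ones into the exponent, where the sum of 1/l^2 dominates. *)
Lemma sums_mzv k ks : admissible (k :: ks) ->
  sums (fun i => x i ^+ k * tr ks i.+1) (mzv R (k :: ks)).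
Proof.
move=> /andP[/= /andP[_ pks] k1].
have [S xS] := sums_inv_sq.
have [T eT] : exists T, sums (fun i => eps (size ks) i * x i) T.
  case E : (size ks) => [|j].
    by exists S; apply: sums_ext xS => // i; rewrite eps0 expr2.
  have [T eT] : exists T, sums (fun i => eps 0 i * x i ^+ j.+2) T.
    apply: sums_dominated xS => i; rewrite eps0 mulr_ge0 ?exprn_ge0 ?xinv_ge0 //=.
    by rewrite -exprS; apply: ler_wiXn2l; rewrite ?xinv_ge0 ?xinv_le1.
  by exists T; have := sums_eps_dual eT; apply: sums_ext => // i; rewrite expr1.
have [] := @sums_dominated R (fun i => x i ^+ k * tr ks i.+1) _ T _ eT.
  move=> i; rewrite mulr_ge0 ?exprn_ge0 ?xinv_ge0 ?mzv_trunc_ge0 //=.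
  rewrite /eps mulrAC -expr2 ler_pM ?exprn_ge0 ?xinv_ge0 ?mzv_trunc_ge0 //.
    by apply: ler_wiXn2l; rewrite ?xinv_ge0 ?xinv_le1.
  exact: mzv_trunc_le_ones.
move=> L fL; suff <- : L = mzv R (k :: ks) by [].
apply/esym/cvg_lim => //; rewrite -cvg_shiftS /=.
by apply: cvg_trans fL; apply: near_eq_cvg; near=> n; rewrite -mzv_truncE.
Unshelve. all: by end_near. Qed.

Lemma mzv_cvg ks : admissible ks -> tr ks n @[n --> \oo] --> mzv R ks.
Proof.
case: ks => [_|k ks ak]; last first.
  rewrite -cvg_shiftS; apply: cvg_trans (sums_mzv ak); apply: near_eq_cvg.
  by near=> n; rewrite -mzv_truncE.
have tr1 : tr [::] = cst 1 by apply/funext.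
by rewrite /mzv tr1 lim_cst //; exact: cvg_cst.
Unshelve. all: by end_near. Qed.

Lemma sums_mzv1 k : (1 < k)%N -> sums (fun i => x i ^+ k) (mzv R [:: k]).
Proof.
move=> k1; have ak : admissible [:: k] by rewrite /admissible /= k1 ltnW.
by apply: sums_ext (sums_mzv ak) => // i; rewrite mulr1.
Qed.

(** The shift by 2 makes every pair [j], [k] admissible and turns duality into a plain exchange of
    arguments. *)
Definition hook j k : R := mzv R (k.+2 :: ones j).

Lemma admissible_hook j k : admissible (k.+2 :: ones j).
Proof. by rewrite /admissible /index_pos /= all_nseq /= orbT. Qed.

Lemma sums_hook j k : sums (fun i => eps j i * x i ^+ k.+1) (hook j k).
Proof.
apply: sums_ext (sums_mzv (admissible_hook j k)) => // i.
by rewrite /eps exprS; ring.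
Qed.

Lemma hook_dual j k : hook j k = hook k j.
Proof. exact: sums_unique (sums_eps_dual (@sums_hook j k)) (@sums_hook k j). Qed.

End HeightOneDuality.

(** * The symmetric kernel *)

Section SymmetricKernel.
Variable R : realType.
Implicit Types (i j k m n : nat).
Local Notation tr := (mzv_trunc R).
Local Notation x := (@xinv R).
Local Notation eps := (@eps R).
Local Notation hook := (@hook R).

Definition harm i : R := \sum_(l < i) x l.

Lemma tr_ones1 i : tr (ones 1) i.+1 = harm i.
Proof.
by rewrite mzv_truncE; apply: eq_bigr => l _; rewrite mulr1 expr1.
Qed.

Lemma harmS i : harm i.+1 = harm i + x i.
Proof. exact: big_ord_recr. Qed.

Lemma harm_ge0 i : 0 <= harm i.
Proof. by apply: sumr_ge0 => l _; exact: xinv_ge0. Qed.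

Lemma harm_mean_cvg0 m : harm n / (m + n).+1%:R @[n --> \oo] --> (0 : R).
Proof.
have := cesaro (@cvg_inv_nat R); rewrite /arithmetic_mean => H.
apply: (@squeeze0 _ _ (fun n => n.+1%:R^-1 * harm n.+1)); last first.
  apply: cvg_trans H; apply: near_eq_cvg; near=> n.
  by rewrite /= seriesEnat /= big_mkord.
move=> n; rewrite mulr_ge0 ?harm_ge0 ?invr_ge0 //= mulrC.
apply: ler_pM; rewrite ?harm_ge0 ?invr_ge0 //.
  by rewrite lef_pV2 ?posrE ?ltr0Sn // ler_nat ltnS leq_addl.
by rewrite harmS lerDl xinv_ge0.
Unshelve. all: by end_near. Qed.

(* [kern i j] is, up to the index shift [m = i + 1], [a = j + 1], the symmetric
   kernel [K(m, a)] with [(a + m) K(m, a) = a K(m, a-1) + 1/(a-1)]. *)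
Fixpoint kern i j : R :=
  if j is j'.+1 then (j.+1%:R * kern i j' + x j') / (i + j).+2%:R
  else harm i / i.+2%:R.

Lemma kernS i j : (i + j.+1).+2%:R * kern i j.+1 = j.+2%:R * kern i j + x j.
Proof. by rewrite /= mulrC divfK // pnatr_eq0. Qed.

Lemma kern_ge0 i j : 0 <= kern i j.
Proof.
elim: j => [|j IH] /=; first by rewrite divr_ge0 ?harm_ge0.
by rewrite divr_ge0 // addr_ge0 ?xinv_ge0 // mulr_ge0.
Qed.

(** The defining recurrence in the other variable. In the induction on [j], after clearing
    denominators, the sides differ by [j.+1%:R * x j - i.+1%:R * x i], which is 1 - 1. *)
Lemma kernSl i j : (i.+1 + j).+2%:R * kern i.+1 j = i.+2%:R * kern i j + x i.
Proof.
elim: j => [|j IH].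
  by rewrite /= addn0 harmS !(mulrC _%:R) !divfK // pnatr_eq0.
have nz : (i + j).+3%:R != 0 :> R by rewrite pnatr_eq0.
have xi : i.+1%:R * x i = 1 by rewrite /xinv mulfV // pnatr_eq0.
have xj : j.+1%:R * x j = 1 by rewrite /xinv mulfV // pnatr_eq0.
have K1 := kernS i.+1 j; have K2 := kernS i j.
move: IH K1 K2 nz xi xj; rewrite !addSn !addnS -!natr1 natrD.
move: (kern i.+1 j) (kern i.+1 j.+1) (kern i j.+1) (kern i j) (x i) (x j).
move: (i%:R) (j%:R) => a b k1 k2 k3 k4 xi xj IH K1 K2 nz Xi Xj.
apply: (mulfI nz); transitivity ((a + b + 1 + 1 + 1) * ((b + 1 + 1) * k1 + xj)).
  by rewrite -K1.
transitivity
  ((b + 1 + 1) * ((a + b + 1 + 1 + 1) * k1) + (a + b + 1 + 1 + 1) * xj).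
  by ring.
rewrite IH; transitivity
  ((a + 1 + 1) * ((a + b + 1 + 1 + 1) * k3) + (a + b + 1 + 1 + 1) * xi);
  last by ring.
rewrite K2; apply/eqP; rewrite -subr_eq0.
rewrite (_ : _ - _ = (b + 1) * xj - (a + 1) * xi); last by ring.
by rewrite Xi Xj subrr.
Qed.

(** [kernS] and [kernSl] are mirror images, so symmetry propagates from the corner [i = j = 0]. *)
Lemma kernC i j : kern i j = kern j i.
Proof.
have nz n : n.+1%:R != 0 :> R by rewrite pnatr_eq0.
elim: i j => [|i IH] j.
  elim: j => [|j IHj] //; apply: (mulfI (nz (0 + j.+1).+1)).
  by rewrite kernS IHj addnC kernSl.
elim: j => [|j IHj]; last first.
  apply: (mulfI (nz (i.+1 + j.+1).+1)).
  by rewrite kernSl IH [in RHS]addnC kernS.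
by apply: (mulfI (nz (i.+1 + 0).+1)); rewrite kernSl IH [in RHS]addnC kernS.
Qed.

Lemma kern_cvg0 i : kern i n @[n --> \oo] --> (0 : R).
Proof.
elim: i => [|i IH].
  by under eq_fun do rewrite kernC; exact: (@harm_mean_cvg0 1).
have E n : kern i.+1 n = (i.+2%:R * kern i n + x i) / (i.+2 + n).+1%:R.
  by apply: (mulIf (_ : (i.+2 + n).+1%:R != 0)); rewrite ?pnatr_eq0 //
    divfK ?pnatr_eq0 // mulrC -kernSl.
under eq_fun do rewrite E.
apply: (@cvg_div_nat R _ (i.+2%:R * 0 + x i)).
by apply: cvgD; [exact: cvgMl_tmp | exact: cvg_cst_seq].
Qed.

(** Subtract [j.+2%:R * kern i j.+1] from [kernS] and divide by (i+1)(j+2): only differences in [j]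
    remain, as 1/((j+1)(j+2)) is itself one. *)
Lemma kern_tele i j :
  kern i j.+1 * x j.+1 = x i * (kern i j - kern i j.+1 + (x j - x j.+1)).
Proof.
have := kernS i j; rewrite /xinv addnS -!natr1 natrD.
have : i.+1%:R != 0 :> R by rewrite pnatr_eq0.
have : j.+1%:R != 0 :> R by rewrite pnatr_eq0.
have : j.+2%:R != 0 :> R by rewrite pnatr_eq0.
rewrite -!natr1; move: (i%:R) (j%:R) (kern i j.+1) (kern i j) => a b k l.
move=> b2 b1 a1 E; apply: (mulfI a1); apply: (mulfI b2).
transitivity ((a + 1) * k); first by field.
transitivity (((b + 1 + 1) * l + (b + 1)^-1) - (b + 1 + 1) * k); last by field; rewrite ?a1 ?b1 ?b2.
by rewrite -E; ring.
Qed.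

(** The moment [\sum_a eps k a * kern i a], computed recursively; [hook 0 k'] is zeta(k'+2). *)
Fixpoint kmom k i : R :=
  if k is k'.+1 then x i * (kmom k' i + hook 0 k') else x i * (harm i + 1).

Lemma kern_tail i N : sums (fun j => kern i (N.+1 + j)%N * x (N.+1 + j)%N)
  (x i * (kern i N + x N)).
Proof.
have := sumsZ (x i) (sumsD (sums_telescope_from N (@kern_cvg0 i))
  (sums_telescope_from N (@cvg_inv_nat R))).
by apply: sums_ext => // j; rewrite addSn kern_tele.
Qed.

Lemma sums_eps_kern k i : sums (fun a => eps k a * kern i a) (kmom k i).
Proof.
elim: k => [|k IH].
  (* [kern_tail i 0] starts after index 0, so the first term [kern i 0] is added separately. *)
  have := @sums_recl R (fun a => eps 0 a * kern i a) _ (sums_ext (fun j => _) erefl (@kern_tail i 0)).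
  move=> H; apply: sums_ext (H _) => // [|j]; last by rewrite eps0 mulrC.
  rewrite /= eps0 /xinv invr1 mul1r.
  by field; rewrite -(natrD _ 1 i) -(natrD _ 2 i) !pnatr_eq0.
have := @sums_triangle R (eps k) (fun a => kern i a * x a)
  (fun a => x i * (kern i a + x a)) (kmom k.+1 i).
move=> H; apply: sums_ext (H _ _ _ _) => //.
- by move=> a; rewrite epsS; ring.
- exact: eps_ge0.
- by move=> a; rewrite mulr_ge0 ?xinv_ge0 ?kern_ge0.
- exact: kern_tail.
(* The summand [x a] in the tail contributes zeta(2, 1^k), which duality turns into zeta(k+2). *)
have H0 := @sums_hook R k 0; rewrite hook_dual in H0.
apply: sums_ext (sumsZ (x i) (sumsD IH H0)) => // a.
by rewrite expr1; ring.
Qed.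

(** Both series come from the double sum of [eps n i * eps k a * kern i a], and the kernel is
    symmetric. *)
Lemma sums_kmom_sym n k T : sums (fun i => eps n i * kmom k i) T ->
  sums (fun i => eps k i * kmom n i) T.
Proof.
apply: (@sums_exchange _ (fun i a => eps n i * (eps k a * kern i a))).
- by move=> i a; exact: mulr_ge0 (eps_ge0 _ _ _) (mulr_ge0 (eps_ge0 _ _ _) (kern_ge0 _ _)).
- by move=> i; apply: (sumsZ (eps n i)); exact: sums_eps_kern.
- move=> a; apply: sums_ext (sumsZ (eps k a) (@sums_eps_kern n a)) => //.
  by move=> i; rewrite kernC mulrCA.
Qed.

Lemma kmomE k i : kmom k i =
  x i ^+ k.+1 * (harm i + 1) + \sum_(r < k) hook 0 r * x i ^+ (k - r).
Proof.
elim: k => [|k IH] /=; first by rewrite big_ord0 addr0.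
have E : \sum_(r < k) hook 0 r * x i ^+ (k.+1 - r) =
    x i * \sum_(r < k) hook 0 r * x i ^+ (k - r).
  rewrite mulr_sumr; apply: eq_bigr => r _.
  by rewrite subSn ?(ltnW (ltn_ord r)) // exprS mulrCA.
by rewrite IH big_ord_recr /= E subSnn [x i ^+ k.+2]exprS; ring.
Qed.

End SymmetricKernel.

(** * The star values zeta^star(k, 1, ..., 1) *)

Section StarHooks.
Variable R : realType.
Implicit Types (a d i j k m n q : nat).
Local Notation tr := (mzv_trunc R).
Local Notation x := (@xinv R).
Local Notation eps := (@eps R).
Local Notation hook := (@hook R).
Local Notation harm := (@harm R).
Local Notation kmom := (@kmom R).

(* The complete homogeneous polynomial of degree [j] in [1, 1/2, ..., 1/m]. *)
Fixpoint chom j m : R :=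
  if j is j'.+1 then \sum_(i < m) x i * chom j' i.+1 else 1.

Lemma chomS j m : chom j.+1 m.+1 = chom j.+1 m + x m * chom j m.+1.
Proof. exact: big_ord_recr. Qed.

Lemma xinvK m : m.+1%:R * x m = 1.
Proof. by rewrite /xinv mulfV // pnatr_eq0. Qed.

Lemma xinv_diff m i :
  x i * (m.+1%:R * x (m.+1 + i) - m%:R * x (m + i)) = x (m + i) - x (m + i).+1.
Proof.
have := xinvK i; have := xinvK (m + i); have := xinvK (m + i).+1.
rewrite addSn -!natr1 natrD;
move: (x (m + i).+1) (x (m + i)) (x i) (m%:R) (i%:R) => u v w a b U V W.
have b0 : b + 1 != 0 by apply: contra_eq_neq W => ->; rewrite mul0r eq_sym oner_eq0.
apply: (mulfI b0); rewrite mulrA W mul1r; apply/eqP; rewrite -subr_eq0.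
rewrite (_ : _ - _ = (a + b + 1 + 1) * u - (a + b + 1) * v); last by ring.
by rewrite U V subrr.
Qed.

Lemma xinv_mul i q : x q * x (i + q).+1 = x i * (x q - x (i + q).+1).
Proof.
have := xinvK i; have := xinvK q; have := xinvK (i + q).+1.
rewrite -!natr1 natrD;
move: (x (i + q).+1) (x q) (x i) (i%:R) (q%:R) => u v w a b U V W.
have a0 : a + 1 != 0 by apply: contra_eq_neq W => ->; rewrite mul0r eq_sym oner_eq0.
apply: (mulfI a0); rewrite [RHS]mulrA W mul1r.
have -> : v - u = v * ((a + b + 1 + 1) * u) - u * ((b + 1) * v).
  by rewrite U V !mulr1.
ring.
Qed.

(* Difference in [m]: the claim for [chom j] at [m + 1] is the increment of
   the claim for [chom j.+1] from [m] to [m + 1]. *)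
Lemma sums_eps_chom j m :
  sums (fun i => eps j i * (m%:R * x (m + i))) (chom j.+1 m).
Proof.
elim: j m => [|j IHj]; elim=> [|m IH].
- by apply: sums_ext (@sums0 R) => [i|]; rewrite /= ?mul0r ?mulr0 ?big_ord0.
- have := sumsD IH (sums_telescope_from m (@cvg_inv_nat R)).
  apply: sums_ext => [i|]; last by rewrite chomS mulr1.
  by rewrite eps0 -/(x (m + i)) -/(x (m + i).+1) -xinv_diff; ring.
- by apply: sums_ext (@sums0 R) => [i|]; rewrite /= ?mul0r ?mulr0 ?big_ord0.
have := @sums_triangle R (eps j) (fun i => x (m + i) - x (m + i).+1)
  (fun i => x (m + i.+1)) (x m * chom j.+1 m.+1).
move=> H; have {}H := sumsD IH (H _ _ _ _).
apply: sums_ext (H _ _ _ _) => [i||||i|].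
- by rewrite -xinv_diff epsS; ring.
- by rewrite -chomS.
- exact: eps_ge0.
- by move=> i; rewrite subr_ge0 lef_pV2 ?posrE ?ltr0Sn // ler_nat.
- have := sums_telescope_from (m + i.+1) (@cvg_inv_nat R).
  by apply: sums_ext => // q; rewrite addnA.
- apply: sums_ext (sumsZ (x m) (IHj m.+1)) => // i.
  rewrite addSnnS; transitivity ((m.+1%:R * x m) * (eps j i * x (m + i.+1))).
    by ring.
  by rewrite xinvK mul1r.
Qed.

(** * The Tornheim-type double series *)

Lemma sums_harm n : sums (fun q => x q - x (n + q)) (harm n).
Proof.
elim: n => [|n IH].
  by apply: sums_ext (@sums0 R) => [q|]; rewrite ?subrr // /harm big_ord0.
have := sumsD IH (sums_telescope_from n (@cvg_inv_nat R)).
by apply: sums_ext => [q|]; rewrite -?harmS // addrA subrK.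
Qed.

(** The inner sum [\sum_q x q ^+ a.+1 * x (i + q).+1]. Partial fractions ([xinv_mul]) split off a
    zeta value and lower the exponent of [x q] by one. *)
Fixpoint smom a i : R :=
  if a is a'.+1 then x i * (hook 0 a' - smom a' i) else x i * harm i.+1.

Lemma sums_smom a i : sums (fun q => x q ^+ a.+1 * x (i + q).+1) (smom a i).
Proof.
elim: a => [|a IH].
  have := sumsZ (x i) (@sums_harm i.+1).
  by apply: sums_ext => // q; rewrite expr1 addSn xinv_mul.
have x2 := @sums_mzv1 R a.+2 isT.
have := sumsZ (x i) (sumsB x2 IH).
apply: sums_ext => // q.
by rewrite [_ ^+ a.+2]exprSr -!mulrA -mulrBr mulrCA -xinv_mul; ring.
Qed.

Lemma smomE a i : smom a i = (-1) ^+ a *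
  (x i ^+ a.+1 * harm i.+1 - \sum_(r < a) (-1) ^+ r * hook 0 r * x i ^+ (a - r)).
Proof.
elim: a => [|a IH]; first by rewrite big_ord0 subr0 mul1r expr1.
have E : \sum_(r < a) (-1) ^+ r * hook 0 r * x i ^+ (a.+1 - r) =
    x i * \sum_(r < a) (-1) ^+ r * hook 0 r * x i ^+ (a - r).
  rewrite mulr_sumr; apply: eq_bigr => r _.
  by rewrite subSn ?(ltnW (ltn_ord r)) // exprS mulrCA.
rewrite [smom _ _]/= IH big_ord_recr /= E subSnn [x i ^+ a.+2]exprS [(-1) ^+ a.+1]exprS.
have s2 : (-1) ^+ a * (-1) ^+ a = 1 :> R by rewrite -expr2 sqrr_sign.
move: s2; move: ((-1) ^+ a) => s s2.
rewrite [RHS](_ : _ = (s * s) * (x i * hook 0 a) - x i * (s * (x i ^+ a.+1 * harm i.+1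
  - \sum_(r < a) (-1) ^+ r * hook 0 r * x i ^+ (a - r)))); last by ring.
by rewrite s2; ring.
Qed.

(** The series [\sum_l e_d(1, ..., 1/(l-1)) H_(l-1) / l^(a+2)], expressed in multiple zeta values by
    the harmonic product. *)
Definition vhar d a : R :=
  \sum_(w <- stuffle (ones d) (ones 1)) mzv R (a.+2 :: w).

Lemma sums_vhar d a : sums (fun i => eps d i * (x i ^+ a.+1 * harm i)) (vhar d a).
Proof.
pose F w i := x i ^+ a.+2 * tr w i.+1.
have pd : index_pos (ones d) by rewrite /index_pos all_nseq orbT.
have FS w : w \in stuffle (ones d) (ones 1) -> sums (F w) (mzv R (a.+2 :: w)).
  move=> /(allP (@stuffle_pos _ (ones 1) pd isT)) pw; apply: sums_mzv.
  by rewrite /admissible /= andbT.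
apply: sums_ext (sums_sum FS) => // i.
by rewrite /F -mulr_sumr -mzv_trunc_stuffle tr_ones1 /eps [x i ^+ a.+2]exprS; ring.
Qed.

(** The double sum of [eps d i * eps a j * kern i j], evaluated through [kmomE]. *)
Definition ymom d a : R :=
  vhar d a + hook d a + \sum_(r < a) hook 0 r * hook d (a - r).-1.

Lemma sums_eps_pow d a (r : 'I_a) :
  sums (fun i => eps d i * x i ^+ (a - r)) (hook d (a - r).-1).
Proof.
have := @sums_hook R d (a - r).-1.
by rewrite prednK // subn_gt0.
Qed.

Lemma sums_eps_kmom d a : sums (fun i => eps d i * kmom a i) (ymom d a).
Proof.
have S (r : 'I_a) := sumsZ (hook 0 r) (@sums_eps_pow d a r).
have := sumsD (sumsD (@sums_vhar d a) (@sums_hook R d a)) (sums_ord S).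
apply: sums_ext => // i; rewrite kmomE mulrDr [X in _ = _ + X]mulr_sumr; congr (_ + _).
  by ring.
by apply: eq_bigr => r _; rewrite mulrCA.
Qed.

Lemma ymom_sym d a : ymom d a = ymom a d.
Proof.
exact: sums_unique (sums_kmom_sym (@sums_eps_kmom d a)) (@sums_eps_kmom a d).
Qed.

(* The value of [\zeta^star(a + 2, 1, ..., 1)] with [d + 1] ones. *)
Definition starhook d a : R := (-1) ^+ a * (vhar d a + hook d a.+1
  - \sum_(r < a) (-1) ^+ r * hook 0 r * hook d (a - r).-1).

(** Expanding [chom] by [sums_eps_chom] gives the double series of
    [eps d i * x q ^+ a.+1 * x (i + q).+1]; summing over [q] first yields [smom], whose closed form
    gives [starhook]. *)
Lemma sums_star d a : sums (fun q => x q ^+ a.+2 * chom d.+1 q.+1) (starhook d a).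
Proof.
apply: (@sums_exchange R
  (fun i q => eps d i * (x q ^+ a.+1 * x (i + q).+1)) (fun i => eps d i * smom a i)).
- move=> i q; apply: mulr_ge0 (eps_ge0 _ _ _) _.
  by rewrite mulr_ge0 ?exprn_ge0 ?xinv_ge0.
- by move=> i; apply: (sumsZ (eps d i)); exact: sums_smom.
- move=> q; apply: sums_ext (sumsZ (x q ^+ a.+2) (@sums_eps_chom d q.+1)) => // i.
  rewrite addSn [(q + i)%N]addnC.
  transitivity ((q.+1%:R * x q) * (eps d i * (x q ^+ a.+1 * x (i + q).+1))).
    by rewrite [x q ^+ a.+2]exprSr; ring.
  by rewrite xinvK mul1r.
have S (r : 'I_a) := sumsZ ((-1) ^+ r * hook 0 r) (@sums_eps_pow d a r).
have := sumsZ ((-1) ^+ a)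
  (sumsB (sumsD (@sums_vhar d a) (@sums_hook R d a.+1)) (sums_ord S)).
apply: sums_ext => // i; rewrite smomE [RHS]mulrCA [in RHS]mulrBr.
rewrite [X in _ = _ * (_ - X)]mulr_sumr; congr (_ * (_ - _)).
  by rewrite harmS [x i ^+ a.+2]exprSr; ring.
by apply: eq_bigr => r _; rewrite mulrCA.
Qed.

(** The term [vhar d a] enters both [starhook] and [ymom], so the symmetric [ymom] can absorb it. In
    the leftover products the factor [1 + (-1) ^+ r] keeps only the even zeta values among
    [hook 0 r]. *)
Lemma hook_star d a : hook d.+1 a + (-1) ^+ a * starhook d a =
  (hook d.+1 a + hook d a.+1) - hook d a + ymom d a
  - \sum_(r < a) (1 + (-1) ^+ r) * hook 0 r * hook d (a - r).-1.
Proof.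
rewrite /starhook /ymom mulrA -expr2 sqrr_sign mul1r.
have -> : \sum_(r < a) (1 + (-1) ^+ r) * hook 0 r * hook d (a - r).-1 =
    \sum_(r < a) hook 0 r * hook d (a - r).-1 +
    \sum_(r < a) (-1) ^+ r * hook 0 r * hook d (a - r).-1.
  by rewrite -big_split; apply: eq_bigr => r _ /=; ring.
ring.
Qed.

End StarHooks.

(** * Alternating sums of harmonic products *)

Local Arguments mzv_trunc : simpl never.

Section AlternatingStuffle.
Variable R : realType.
Implicit Types (a d i j k m n N : nat) (ks ls w : seq nat) (phi psi : seq nat -> R).
Local Notation tr := (mzv_trunc R).
Local Notation x := (@xinv R).

Lemma stuffle_nil ks : stuffle ks [::] = [:: ks]. Proof. by case: ks. Qed.

Lemma sum_stuffle_cons a ks d ls phi :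
  \sum_(w <- stuffle (a :: ks) (d :: ls)) phi w =
  \sum_(w <- stuffle ks (d :: ls)) phi (a :: w) +
  \sum_(w <- stuffle (a :: ks) ls) phi (d :: w) +
  \sum_(w <- stuffle ks ls) phi ((a + d)%N :: w).
Proof.
rewrite [stuffle (a :: ks) _]/= -/(stuffle (a :: ks) ls).
by rewrite !big_cat !big_map /= addrA.
Qed.

(* The coefficient of [t^n] in [E(-t) z_ks * E(t)], where
   [E(t) = \sum_i z_1^i t^i] and [*] is the harmonic product. *)
Definition alt ks n phi : R := \sum_(i < n.+1)
  (-1) ^+ i * \sum_(w <- stuffle (ones i ++ ks) (ones (n - i))) phi w.

Lemma eq_alt ks n phi psi : phi =1 psi -> alt ks n phi = alt ks n psi.
Proof.
by move=> E; apply: eq_bigr => i _; congr (_ * _); apply: eq_bigr => w _.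
Qed.

Lemma altD ks n phi psi c :
  alt ks n (fun w => phi w + c * psi w) = alt ks n phi + c * alt ks n psi.
Proof.
rewrite /alt mulr_sumr -big_split; apply: eq_bigr => i _ /=.
by rewrite big_split /= -mulr_sumr mulrDr mulrCA.
Qed.

Lemma altM ks n phi : (forall ks ls, index_pos ks -> index_pos ls ->
    phi ks * phi ls = \sum_(w <- stuffle ks ls) phi w) -> index_pos ks ->
  alt ks n phi =
  \sum_(i < n.+1) (-1) ^+ i * (phi (ones i ++ ks) * phi (ones (n - i))).
Proof.
move=> phiM pk; apply: eq_bigr => i _; rewrite phiM //.
  by rewrite /index_pos all_cat all_nseq orbT.
by rewrite /index_pos all_nseq orbT.
Qed.

Lemma alt0 ks phi : alt ks 0 phi = phi ks.
Proof. by rewrite /alt big_ord1 stuffle_nil big_seq1 mul1r. Qed.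

Lemma alt1 ks phi :
  alt ks 1 phi = \sum_(w <- stuffle ks (ones 1)) phi w - phi (1%N :: ks).
Proof.
by rewrite /alt !big_ord_recl big_ord0 addr0 mul1r mulN1r stuffle_nil big_seq1.
Qed.

Lemma sum_alt_tele (Q : nat -> R) m :
  \sum_(i < m) (-1) ^+ i.+1 * (Q i + Q i.+1) = (-1) ^+ m * Q m - Q 0%N.
Proof.
elim: m => [|m IH]; first by rewrite big_ord0 mul1r subrr.
by rewrite big_ord_recr /= IH !exprS; ring.
Qed.

(** Split each product by its first letter. Words starting with [z_1] arise from either factor and
    telescope to the end terms; merging two letters [z_1] gives the words starting with [z_2]. *)
Lemma altSS ks n phi : alt ks n.+2 phi =
  \sum_(w <- stuffle ks (ones n.+2)) phi w -
  \sum_(w <- stuffle ks (ones n.+1)) phi (1%N :: w) -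
  alt ks n (fun w => phi (2%N :: w)).
Proof.
pose P i j psi := \sum_(w <- stuffle (ones i ++ ks) (ones j)) psi w.
pose phi1 w := phi (1%N :: w); pose phi2 w := phi (2%N :: w).
pose Q i := P i (n.+1 - i)%N phi1.
have step (i : 'I_n.+1) :
    P i.+1 (n.+1 - i)%N phi = Q i + Q i.+1 + P i (n - i)%N phi2.
  have ni : (i <= n)%N by rewrite -ltnS ltn_ord.
  by rewrite /Q subSS subSn //; exact: sum_stuffle_cons.
have last : P n.+2 (n.+1 - n.+1)%N phi = Q n.+1.
  by rewrite /Q subnn /P !stuffle_nil !big_seq1.
rewrite {1}/alt big_ord_recl mul1r subn0 -[X in X + _]/(P 0%N n.+2 phi).
rewrite -addrA; congr (_ + _).
have -> : \sum_(w <- stuffle ks (ones n.+1)) phi (1%N :: w) = Q 0%N.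
  by rewrite /Q subn0.
rewrite big_ord_recr /= -/(P n.+2 (n.+1 - n.+1)%N phi) last.
have -> : \sum_(i < n.+1) (-1) ^+ bump 0 i *
      \sum_(w <- stuffle (ones (bump 0 i) ++ ks) (ones (n.+2 - bump 0 i))) phi w =
    \sum_(i < n.+1) (-1) ^+ i.+1 * (Q i + Q i.+1) - alt ks n phi2.
  rewrite -sumrN -big_split; apply: eq_bigr => i _ /=.
  rewrite -/(P i.+1 (n.+1 - i)%N phi) step -/(P i (n - i)%N phi2).
  by rewrite [_ ^+ i.+1]exprS; ring.
by rewrite sum_alt_tele /bump add1n [_ ^+ n.+2]exprS; ring.
Qed.

Lemma sum_stuffle1 k n phi :
  \sum_(w <- stuffle [:: k] (ones n.+1)) phi w -
  \sum_(w <- stuffle [:: k] (ones n)) phi (1%N :: w) =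
  phi (k :: ones n.+1) + phi (k.+1 :: ones n).
Proof.
by rewrite (sum_stuffle_cons k [::] 1 (ones n)) /= !big_seq1 addn1; ring.
Qed.

Lemma alt_k1 k phi :
  alt [:: k] 1 phi = phi [:: k; 1%N] + phi [:: k.+1].
Proof. by rewrite alt1 -[RHS](sum_stuffle1 k 0 phi) (stuffle_nil [:: k]) big_seq1. Qed.

Lemma alt_kSS k n phi : alt [:: k] n.+2 phi =
  phi (k :: ones n.+2) + phi (k.+1 :: ones n.+1) -
  alt [:: k] n (fun w => phi (2%N :: w)).
Proof. by rewrite altSS sum_stuffle1. Qed.

Lemma alt_nilSS n phi : alt [::] n.+2 phi = - alt [::] n (fun w => phi (2%N :: w)).
Proof. by rewrite altSS /= !big_seq1 subrr sub0r. Qed.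

(** Each use of [alt_nilSS] strips a letter [z_2] with a sign: E(-t) * E(t) is the series of
    (-t^2)^m z_2^m. *)
Lemma alt_nilE n phi : alt [::] n phi =
  if odd n then 0 else (-1) ^+ n./2 * phi (nseq n./2 2%N).
Proof.
elim/ltn_ind: n phi => -[_|[_|n IH]] phi.
- by rewrite alt0 mul1r.
- by rewrite alt1 /= big_seq1 subrr.
by rewrite alt_nilSS IH //= negbK; case: odd; rewrite ?oppr0 // exprS mulN1r mulNr.
Qed.

(** The divergent words cancel by [alt_kSS]. The list [s] serves every [phi], so truncated, limiting
    and regularized values can be compared term by term. *)
Lemma alt_admissible k n : (1 < k)%N -> exists2 s : seq (rat * seq nat),
  all (fun p => admissible p.2) s &
  forall phi, alt [:: k] n phi = \sum_(p <- s) ratr p.1 * phi p.2.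
Proof.
move=> k1; have ak m j : admissible ((k + m)%N :: ones j).
  rewrite /admissible /index_pos /= all_nseq orbT andbT.
  by rewrite (leq_trans k1) ?leq_addr // andbT ltn_addr // ltnW.
have ak0 j : admissible (k :: ones j) by rewrite -(addn0 k).
have ak1 j : admissible (k.+1 :: ones j) by rewrite -addn1.
elim/ltn_ind: n => -[_|[_|n IH]].
- exists [:: (1, [:: k])]; first by rewrite /= (ak0 0%N).
  by move=> phi; rewrite alt0 big_seq1 rmorph1 mul1r.
- exists [:: (1, k :: ones 1); (1, [:: k.+1])].
    by rewrite /= (ak0 1%N) (ak1 0%N).
  by move=> phi; rewrite alt_k1 big_cons big_seq1 rmorph1 !mul1r.
have [|s /allP sa sE] := IH n; first by rewrite ltnS leqnSn.
exists ((1, k :: ones n.+2) :: (1, k.+1 :: ones n.+1) ::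
  [seq (- p.1, 2%N :: p.2) | p <- s]).
  rewrite /= (ak0 n.+2) (ak1 n.+1) all_map; apply/allP => p /sa /= /andP[pp _].
  by rewrite /admissible /index_pos /= andbT.
move=> phi; rewrite alt_kSS !big_cons big_map rmorph1 !mul1r sE -addrA.
congr (_ + (_ + _)); rewrite -sumrN; apply: eq_bigr => p _ /=.
by rewrite rmorphN mulNr.
Qed.

(** * Truncated generating functions of star sums *)

Lemma mzv_truncSS k ks N :
  tr (k :: ks) N.+2 = tr (k :: ks) N.+1 + x N ^+ k * tr ks N.+1.
Proof. by rewrite !mzv_truncE big_ord_recr. Qed.

(* Multiplication by the truncation [\prod_(i < N) (1 - t^2 / i^2)] of
   [E(t) E(-t)], on coefficient sequences. *)
Definition sqop N (f : nat -> R) n : R :=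
  \sum_(j < n./2.+1) (-1) ^+ j * tr (nseq j 2%N) N * f (n - j.*2)%N.

Lemma sqop0 N f : sqop N f 0 = f 0%N.
Proof. by rewrite /sqop big_ord1 !mul1r. Qed.

Lemma sqop1 N f : sqop N f 1 = f 1%N.
Proof. by rewrite /sqop big_ord1 !mul1r. Qed.

Lemma sqopSS N f n :
  sqop N.+2 f n.+2 = sqop N.+1 f n.+2 - x N ^+ 2 * sqop N.+1 f n.
Proof.
rewrite /sqop [in LHS]big_ord_recl [X in X - _]big_ord_recl /= !mul1r -!addrA.
congr (_ + _); rewrite mulr_sumr -sumrN -big_split; apply: eq_bigr => j _ /=.
rewrite /bump add1n doubleS !subSS mzv_truncSS.
by rewrite exprS; ring.
Qed.

(** For generating functions the hypotheses say (1 - c t) F = G, a relation that survives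
    multiplication by a power series in t. *)
Lemma sqop_geom N f g (c : R) n : f 0%N = g 0%N ->
  (forall j, f j.+1 = g j.+1 + c * f j) ->
  sqop N f n.+1 = sqop N g n.+1 + c * sqop N f n.
Proof.
move=> f0 fS.
have E (j : nat) : (j <= n./2)%N -> f (n.+1 - j.*2)%N = g (n.+1 - j.*2)%N + c * f (n - j.*2)%N.
  by move=> jn; rewrite subSn ?fS //; lia.
have Es : \sum_(j < n./2.+1) (-1) ^+ j * tr (nseq j 2%N) N * f (n.+1 - j.*2)%N =
  \sum_(j < n./2.+1) (-1) ^+ j * tr (nseq j 2%N) N * g (n.+1 - j.*2)%N + c * sqop N f n.
  rewrite mulr_sumr -big_split; apply: eq_bigr => j _ /=.
  by rewrite E -1?ltnS // mulrDr mulrCA.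
rewrite [LHS]/sqop [sqop N g _]/sqop /= uphalf_half;
case: (boolP (odd n)) => on; last by rewrite add0n.
rewrite add1n [in LHS]big_ord_recr [X in _ = X + _]big_ord_recr /= Es.
(* For odd [n] the sums at [n.+1] have one term more than the sum at [n]; it sits at index 0, where
   [f] and [g] agree. *)
have -> : (n.+1 - n./2.+1.*2 = 0)%N by lia.
by rewrite f0; ring.
Qed.

Lemma sqopD N f g (c : R) n :
  sqop N (fun j => f j + c * g j) n = sqop N f n + c * sqop N g n.
Proof.
rewrite /sqop mulr_sumr -big_split; apply: eq_bigr => j _ /=.
by rewrite mulrDr mulrCA.
Qed.

(** Over i <= N, the product of 1 - t^2/i^2 divided by that of 1 - t/i is the product of 1 + t/i. *)
Lemma sqop_chom N n : sqop N.+1 (fun j => chom R j N) n = tr (ones n) N.+1.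
Proof.
elim: N n => [|N IH] n.
  have t0 j : tr (nseq j.+1 2%N) 1 = 0 by rewrite mzv_truncE big_ord0.
  rewrite /sqop big_ord_recl /= big1 => [|j _]; last by rewrite t0 mulr0 mul0r.
  rewrite !mul1r subn0 addr0; case: n => [|n] //=.
  by rewrite [RHS]mzv_truncE !big_ord0.
have G m : sqop N.+1 (fun j => chom R j N.+1) m.+1 =
    tr (ones m.+1) N.+1 + x N * sqop N.+1 (fun j => chom R j N.+1) m.
  by rewrite -IH; apply: sqop_geom => // j; exact: chomS.
case: n => [|[|n]].
- by rewrite sqop0.
- by have := G 0%N; rewrite !sqop1 !sqop0 => ->; rewrite -[ones 1]/(1%N :: ones 0) mzv_truncSS expr1.
rewrite sqopSS G -[ones n.+2]/(1%N :: ones n.+1) mzv_truncSS -addrA; congr (_ + _).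
by rewrite G expr1; ring.
Qed.

Definition starN k N d : R := \sum_(q < N) x q ^+ k * chom R d q.+1.

(** In E(-t) z_k the letter [k] carries the smallest summation index m, with a factor 1 - t/l for
    each l > m. Multiplying by all 1 + t/l gives the product of all 1 - t^2/l^2 times the sum of
    m^-k over the product of 1 - t/l for l <= m, which generates [starN]. The proof compares
    increments in [N]. *)
Lemma sqop_starN k N n : sqop N.+1 (starN k N) n = alt [:: k] n (tr ^~ N.+1).
Proof.
elim: N n => [|N IH] n.
  rewrite /sqop big1 => [|j _]; last by rewrite /starN big_ord0 mulr0.
  rewrite /alt big1 // => i _; rewrite -mzv_trunc_stuffle.
  suff -> : tr (ones i ++ [:: k]) 1 = 0 by rewrite mul0r mulr0.
  by case: (ones i) => [|j s]; rewrite mzv_truncE big_ord0.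
have S : starN k N.+1 = fun j => starN k N j + x N ^+ k * chom R j N.+1.
  by apply/funext => j; exact: big_ord_recr.
rewrite S sqopD sqop_chom.
case: n => [|[|n]].
- have := IH 0%N; rewrite !sqop0 !alt0 => ->.
  by rewrite -[ones 0]/[::] mzv_truncSS.
- have := IH 1%N; rewrite !sqop1 !alt_k1 => ->.
  have -> : tr (ones 1) N.+2 = tr [:: 1%N] N.+1 + x N ^+ 1 * tr [::] N.+1.
    exact: mzv_truncSS.
  by rewrite !mzv_truncSS [x N ^+ k.+1]exprS !mzv_trunc_nil expr1; ring.
rewrite sqopSS !IH !alt_kSS.
have -> : alt [:: k] n (fun w => tr (2%N :: w) N.+2) =
  alt [:: k] n (fun w => tr (2%N :: w) N.+1) + x N ^+ 2 * alt [:: k] n (tr ^~ N.+1).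
  by rewrite -altD; apply: eq_alt => w; rewrite mzv_truncSS.
rewrite !mzv_truncSS.
rewrite [x N ^+ k.+1]exprS expr1.
ring.
Qed.

(* The value of [\zeta^star(a + 2, 1, ..., 1)] with [d] ones. *)
Definition starv a d : R := if d is d'.+1 then starhook R d' a else hook R 0 a.

Lemma starN_cvg a d : starN a.+2 N d @[N --> \oo] --> starv a d.
Proof.
case: d => [|d]; last exact: sums_star.
have H : sums (fun q => x q ^+ a.+2 * chom R 0 q.+1) (hook R 0 a).
  by apply: sums_ext (@sums_mzv1 R a.+2 isT) => // q; rewrite mulr1.
exact: H.
Qed.

Lemma cvg_sum_seq (I : eqType) (s : seq I) (F : I -> nat -> R) (l : I -> R) :
  (forall p, p \in s -> F p n @[n --> \oo] --> l p) ->
  \sum_(p <- s) F p n @[n --> \oo] --> \sum_(p <- s) l p.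
Proof.
elim: s => [|p s IH] Fl.
  by rewrite big_nil; under eq_fun do rewrite big_nil; exact: cvg_cst_seq.
rewrite big_cons; under eq_fun do rewrite big_cons.
apply: cvgD; first by apply: Fl; rewrite mem_head.
by apply: IH => q qs; apply: Fl; rewrite inE qs orbT.
Qed.

Lemma mzv_cvg_shift ks : admissible ks -> tr ks N.+1 @[N --> \oo] --> mzv R ks.
Proof. by move=> ak; exact: cvg_shiftn 1 (@mzv_cvg R ks ak). Qed.
Arguments mzv_cvg_shift {ks} _ t _.

Lemma sqop_cvg (f : nat -> R) (fN : nat -> nat -> R) n :
  (forall d, fN N d @[N --> \oo] --> f d) ->
  sqop N.+1 (fN N) n @[N --> \oo] -->
    \sum_(j < n./2.+1) (-1) ^+ j * mzv R (nseq j 2%N) * f (n - j.*2)%N.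
Proof.
move=> fNf; apply: cvg_sum_seq => j _.
have aj : admissible (nseq j 2%N).
  by rewrite /admissible /index_pos all_nseq orbT /=; case: (val j).
exact: (cvgM (cvgM (cvg_cst_seq ((-1) ^+ j)) (mzv_cvg_shift aj)) (fNf (n - j.*2)%N)).
Qed.

(** The limit of [sqop_starN]: by [alt_admissible] its right side is a fixed finite combination of
    convergent truncations. *)
Lemma alt_mzv a n : alt [:: a.+2] n (mzv R) =
  \sum_(j < n./2.+1) (-1) ^+ j * mzv R (nseq j 2%N) * starv a (n - j.*2)%N.
Proof.
have L := @sqop_cvg (starv a) (starN a.+2) n (@starN_cvg a).
have [s /allP sa sE] := @alt_admissible a.+2 n isT.
have E N : sqop N.+1 (starN a.+2 N) n = \sum_(p <- s) ratr p.1 * tr p.2 N.+1.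
  by rewrite sqop_starN sE.
rewrite (funext E) in L.
have H p : p \in s ->
    ratr p.1 * tr p.2 N.+1 @[N --> \oo] --> (ratr p.1 * mzv R p.2 : R).
  by move=> /sa /mzv_cvg_shift H; exact: (cvgM (cvg_cst_seq (ratr p.1)) H).
have uniq (u : nat -> R) (l l' : R) : u n @[n --> \oo] --> l ->
  u n @[n --> \oo] --> l' -> l = l' by exact: cvg_unique.
by rewrite sE; exact: uniq (cvg_sum_seq H) L.
Qed.

End AlternatingStuffle.

(** * Reduction modulo zeta(2) *)

Section ModuloZeta2.
Variable R : realType.
Implicit Types (a b d i j k m n r : nat) (ks ls w : seq nat) (u v : R).
Local Notation tr := (mzv_trunc R).
Local Notation x := (@xinv R).
Local Notation eps := (@eps R).
Local Notation hook := (@hook R).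
Local Notation harm := (@harm R).
Local Notation starhook := (@starhook R).
Local Notation starv := (@starv R).
Local Notation span := (mzv_span R).
Local Notation ideal := (zeta2_ideal R).

(** * Closure properties of the ideal zeta(2) Z *)

Lemma spanN u : span u -> span (- u).
Proof. by move=> /(mzv_spanZ (-1)); rewrite rmorphN1 mulN1r. Qed.

Lemma ideal0 : ideal 0.
Proof. by exists 0; [exact: mzv_span0 | rewrite mulr0]. Qed.

Lemma idealD u v : ideal u -> ideal v -> ideal (u + v).
Proof.
move=> [y sy <-] [z sz <-]; exists (y + z); first exact: mzv_spanD.
by rewrite mulrDr.
Qed.

Lemma idealM u v : span u -> ideal v -> ideal (u * v).
Proof.
move=> su [z sz <-]; exists (u * z); first exact: mzv_spanM.
by rewrite mulrCA.
Qed.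

Lemma idealZ (q : rat) u : ideal u -> ideal (ratr q * u).
Proof.
move=> [z sz <-]; exists (ratr q * z); first exact: mzv_spanZ.
by rewrite mulrCA.
Qed.

Lemma idealN u : ideal u -> ideal (- u).
Proof. by move=> /(idealZ (-1)); rewrite rmorphN1 mulN1r. Qed.

Lemma idealB u v : ideal u -> ideal v -> ideal (u - v).
Proof. by move=> iu iv; apply: idealD => //; exact: idealN. Qed.

Lemma ideal_sign n u : ideal u -> ideal ((-1) ^+ n * u).
Proof.
by rewrite -signr_odd; case: odd => iu; rewrite ?mul1r // mulN1r; exact: idealN.
Qed.

Lemma ideal_sum n (F : 'I_n -> R) :
  (forall i : 'I_n, ideal (F i)) -> ideal (\sum_(i < n) F i).
Proof.
by move=> FI; apply: (big_ind ideal) => //; [exact: ideal0 | exact: idealD].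
Qed.

Lemma ideal_natl n u : ideal (n.+1%:R * u) -> ideal u.
Proof.
by move=> /(idealZ n.+1%:R^-1); rewrite fmorphV rmorph_nat mulKf.
Qed.

Lemma ideal_natr_mul n u : ideal u -> ideal (n%:R * u).
Proof. by move=> /(idealZ n%:R); rewrite rmorph_nat. Qed.

Lemma ideal_span u : ideal u -> span u.
Proof.
by move=> [z sz <-]; apply: mzv_spanM => //; exact: mzv_span_mzv.
Qed.

Lemma mzv_nil : mzv R [::] = 1.
Proof. by rewrite /mzv (_ : tr [::] = cst 1) ?lim_cst //; apply/funext. Qed.

Lemma span_hook j k : span (hook j k).
Proof. exact/mzv_span_mzv/admissible_hook. Qed.

(** * The sum formula in depth two and Euler's even zeta values *)

Lemma chom1 q : chom R 1 q = harm q.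
Proof. by apply: eq_bigr => i _; rewrite mulr1. Qed.

(** Separating equal from unequal indices evaluates the star value a second time; comparison with
    the formula in [starhook] yields relations among zeta values. *)
Lemma star0E a : starhook 0 a = mzv R [:: a.+2; 1%N] + hook 0 a.+1.
Proof.
have V := @sums_vhar R 0 a; rewrite /vhar /= big_seq1 in V.
apply: sums_unique (@sums_star R 0 a) _.
apply: sums_ext (sumsD V (@sums_hook R 0 a.+1)) => // q.
by rewrite chom1 harmS eps0 [x q ^+ a.+2]exprS; ring.
Qed.

(** A geometric sum in partial-fraction form: the hypothesis holds for y = 1/i, z = 1/l, w =
    1/(l-i). *)
Lemma geometric_diff (y z w : R) a : w * (y - z) = y * z ->
  \sum_(r < a.+1) z ^+ r.+2 * y ^+ (a.+1 - r) = w * z * (y ^+ a.+1 - z ^+ a.+1).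
Proof.
move=> E; elim: a => [|a IH].
  rewrite big_ord1 subn0 /= !expr1; transitivity (w * (y - z) * z); last by ring.
  by rewrite E; ring.
rewrite big_ord_recr /= subSnn expr1.
have -> : \sum_(r < a.+1) z ^+ r.+2 * y ^+ (a.+2 - r) =
    y * \sum_(r < a.+1) z ^+ r.+2 * y ^+ (a.+1 - r).
  rewrite mulr_sumr; apply: eq_bigr => r _.
  by rewrite subSn ?(ltnW (ltn_ord r)) // [y ^+ _.+1]exprS mulrCA.
rewrite IH; have -> : z ^+ a.+3 * y = z ^+ a.+2 * (w * (y - z)).
  by rewrite E exprSr; ring.
by rewrite ![_ ^+ a.+2]exprS; ring.
Qed.

Lemma sum_xinv_rev n : \sum_(i < n) x (n - i.+1) = harm n.
Proof. by rewrite /harm [RHS](reindex_inj rev_ord_inj). Qed.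

(** Euler's sum formula. The double series of 1/(i^(a+1) (l-i) l) over i < l sums by rows to
    zeta^star(a+2, 1), and by columns, after partial fractions, to the left side plus zeta(a+2,
    1). *)
Lemma sum_formula2 a :
  \sum_(r < a.+1) mzv R [:: r.+2; (a.+1 - r)%N] = hook 0 a.+1.
Proof.
suff E : \sum_(r < a.+1) mzv R [:: r.+2; (a.+1 - r)%N] + mzv R [:: a.+2; 1%N] =
    starhook 0 a.
  by apply: (addIr (mzv R [:: a.+2; 1%N])); rewrite E star0E addrC.
pose F i l := x i ^+ a.+1 * (if (l < i.+1)%N then 0 else x (l - i.+1)%N * x l).
pose c l := \sum_(i < l) x i ^+ a.+1 * (x (l - i.+1)%N * x l).
have F0 i l : 0 <= F i l.
  by rewrite /F mulr_ge0 ?exprn_ge0 ?xinv_ge0 //; case: ifP; rewrite ?mulr_ge0 ?xinv_ge0.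
have rows i : sums (F i) (x i ^+ a.+2 * harm i.+1).
  have S : sums (fun q => x (i.+1 + q - i.+1)%N * x (i.+1 + q)%N) (x i * harm i.+1).
    apply: sums_ext (@sums_smom R 0 i) => // q.
    by rewrite addKn addSn expr1.
  have := sumsZ (x i ^+ a.+1) (sums_shift (f := fun l => x (l - i.+1)%N * x l) S).
  by apply: sums_ext => //; rewrite mulrA -exprSr.
have cols l : sums (F ^~ l) (c l).
  apply: sums_ext (@sums_finite R (F ^~ l) l _) => //.
    by apply: eq_bigr => -[i il] _; rewrite /F /= ltnS leqNgt il.
  by move=> i li; rewrite /F ltnS li mulr0.
have total : sums (fun i => x i ^+ a.+2 * harm i.+1) (starhook 0 a).
  by apply: sums_ext (@sums_star R 0 a) => // q; rewrite chom1.
have S1 := sums_exchange F0 rows cols total.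
apply: sums_unique S1.
have V := @sums_vhar R 0 a; rewrite /vhar /= big_seq1 in V.
have ar (r : 'I_a.+1) : admissible [:: r.+2; (a.+1 - r)%N].
  by rewrite /admissible /index_pos /= andbT subn_gt0 ltn_ord.
have := sumsD (sums_ord (fun r : 'I_a.+1 => @sums_mzv R _ _ (ar r))) V.
apply: sums_ext => // l.
have -> : c l = \sum_(i < l) (\sum_(r < a.+1) x l ^+ r.+2 * x i ^+ (a.+1 - r)
    + x l ^+ a.+2 * x (l - i.+1)%N).
  apply: eq_bigr => i _; rewrite (@geometric_diff _ _ (x (l - i.+1)%N)).
    by rewrite [x l ^+ a.+2]exprS; ring.
  have il := ltn_ord i; have := @xinv_mul R (l - i.+1)%N i.
  rewrite (_ : (l - i.+1 + i).+1 = l) ?subnSK ?subnK // 1?ltnW //.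
  by rewrite -addnS subnK.
rewrite big_split -mulr_sumr sum_xinv_rev; congr (_ + _); last first.
  by rewrite eps0 [x l ^+ a.+2]exprS mulrA.
rewrite exchange_big; apply: eq_bigr => r _.
rewrite -mulr_sumr mzv_truncE; congr (_ * _).
by apply: eq_bigr => i _; rewrite mulr1.
Qed.

(* Compare the odd case of [starhook 0 a] with the stuffle products
   [\zeta(r) \zeta(s)] summed by [sum_formula2]. *)
Lemma euler_rec a : odd a -> a.+4%:R * hook 0 a.+1 =
  \sum_(r < a) (1 + (-1) ^+ r) * hook 0 r * hook 0 (a - r).-1.
Proof.
move=> oa; have st := star0E a; set Z21 := mzv R _ in st.
have S2 : starhook 0 a + starhook 0 a =
    \sum_(r < a) (-1) ^+ r * hook 0 r * hook 0 (a - r).-1.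
  rewrite {1}/starhook /vhar /= big_seq1 -/Z21 -st -signr_odd oa mulN1r opprB.
  by rewrite addrC addrCA subrr addr0.
have pr (r : 'I_a) : hook 0 r * hook 0 (a - r).-1 =
    mzv R [:: r.+2; (a.+1 - r)%N] + mzv R [:: (a.+1 - r)%N; r.+2] + hook 0 a.+1.
  have ra := ltn_ord r; rewrite /hook -[ones 0]/[::].
  rewrite mzvM; [|by rewrite /admissible /= ?andbT..].
  rewrite !big_cons big_nil addr0 addrA.
  by rewrite (_ : (a - r).-1.+2 = a.+1 - r)%N; [congr (_ + _ + mzv R [:: _])|]; lia.
have S1 : \sum_(r < a) hook 0 r * hook 0 (a - r).-1 =
    2 * (hook 0 a.+1 - Z21) + a%:R * hook 0 a.+1.
  rewrite (eq_bigr _ (fun (r : 'I_a) _ => pr r)) !big_split /= sumr_const card_ord.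
  congr (_ + _); last by rewrite mulr_natl.
  have -> : \sum_(r < a) mzv R [:: (a.+1 - r)%N; r.+2] =
      \sum_(r < a) mzv R [:: r.+2; (a.+1 - r)%N].
    rewrite (reindex_inj rev_ord_inj); apply: eq_bigr => r _ /=.
    by have ra := ltn_ord r; congr (mzv R [:: _; _]); lia.
  rewrite -sum_formula2 big_ord_recr /= subSnn -/Z21; ring.
transitivity (\sum_(r < a) hook 0 r * hook 0 (a - r).-1 +
    \sum_(r < a) (-1) ^+ r * hook 0 r * hook 0 (a - r).-1).
  by rewrite S1 -S2 st -!natr1; ring.
by rewrite -big_split; apply: eq_bigr => r _ /=; ring.
Qed.

(** Strong induction through [euler_rec]: products with odd [r] have coefficient 0, the others
    contain a smaller even zeta value, and the integer factor can be divided out over the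
    rationals. *)
Lemma even_zeta_ideal r : ~~ odd r -> ideal (hook 0 r).
Proof.
elim/ltn_ind: r => -[_ _|[//|r IH]].
  exists 1; last by rewrite mulr1.
  by rewrite -mzv_nil; exact: mzv_span_mzv.
rewrite /= negbK => or; apply: (@ideal_natl r.+4).
rewrite -/(r.+1.+4) euler_rec //; apply: ideal_sum => s.
have [os|es] := boolP (odd s).
  by rewrite -signr_odd os subrr !mul0r; exact: ideal0.
rewrite mulrC; apply: idealM; first exact: span_hook.
rewrite -signr_odd (negbTE es); apply: (@ideal_natr_mul 2); apply: IH => //.
by rewrite (ltn_trans (ltn_ord s)).
Qed.

(** * The values zeta(2, ..., 2) *)

Lemma sum_stuffle_nseq c d m (phi : seq nat -> R) :
  \sum_(w <- stuffle [:: c] (nseq m d)) phi w =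
  \sum_(b < m.+1) phi (nseq b d ++ c :: nseq (m - b) d) +
  \sum_(b < m) phi (nseq b d ++ (c + d)%N :: nseq (m - b.+1) d).
Proof.
elim: m phi => [|m IH] phi.
  by rewrite big_seq1 big_ord1 big_ord0 addr0.
rewrite (sum_stuffle_cons c [::] d (nseq m d)) IH /= !big_seq1.
rewrite [X in _ = X + _]big_ord_recl [X in _ = _ + X]big_ord_recl /= subn1 /=.
under [X in _ = _ + X + _]eq_bigr do rewrite /bump add1n subSS.
under [X in _ = _ + (_ + X)]eq_bigr do rewrite /bump add1n subSS.
ring.
Qed.

Lemma admissible_twos m : admissible (nseq m 2%N).
Proof. by rewrite /admissible /index_pos all_nseq orbT; case: m. Qed.

(** The harmonic product of zeta(2j+2) with zeta(2, ..., 2) inserts 2j+2 among the twos or merges it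
    into one of them; the merged terms are the same sum for [j.+1] with one two fewer. *)
Lemma even_among_twos_ideal m j : ideal (\sum_(b < m.+1)
  mzv R (nseq b 2%N ++ j.*2.+2 :: nseq (m - b) 2%N)).
Proof.
elim: m j => [|m IH] j.
  by rewrite big_ord1; apply: (@even_zeta_ideal j.*2); rewrite odd_double.
have aj : admissible [:: j.*2.+2] by [].
have := sum_stuffle_nseq j.*2.+2 2 m.+1 (mzv R).
rewrite -mzvM ?admissible_twos // => E.
have -> : \sum_(b < m.+2) mzv R (nseq b 2%N ++ j.*2.+2 :: nseq (m.+1 - b) 2%N) =
    mzv R [:: j.*2.+2] * mzv R (nseq m.+1 2%N) -
    \sum_(b < m.+1) mzv R (nseq b 2%N ++ j.+1.*2.+2 :: nseq (m - b) 2%N).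
  by rewrite E addnC addrK.
apply: idealB (IH _); rewrite mulrC; apply: idealM.
  exact/mzv_span_mzv/admissible_twos.
by apply: (@even_zeta_ideal j.*2); rewrite odd_double.
Qed.

(** At [j = 0] all insertions give the same word, so the sum is m+1 times this value. *)
Lemma twos_ideal m : ideal (mzv R (nseq m.+1 2%N)).
Proof.
apply: (@ideal_natl m); have := even_among_twos_ideal m 0.
rewrite (eq_bigr (fun=> mzv R (nseq m.+1 2%N))).
  by rewrite sumr_const card_ord mulr_natl.
move=> b _; rewrite -[_ :: _]/(nseq (m - b).+1 2%N) -nseqD.
by rewrite addnS subnKC // -ltnS.
Qed.

(** * Reduction of the finite real values to a symmetric expression *)

Lemma alt_mzv_span a n : span (alt [:: a.+2] n (mzv R)).
Proof.
have [s /allP sa ->] := @alt_admissible R a.+2 n isT.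
by apply: mzv_span_sum => p /sa ap; apply: mzv_spanZ; exact: mzv_span_mzv.
Qed.

(** In [alt_mzv] the term [j = 0] is [starv a n], and every other term has a factor zeta(2, ..., 2).
    Its cofactor is a shorter star value, whose membership in the span comes from the same
    induction. *)
Lemma starv_span_ideal a n :
  span (starv a n) /\ ideal (alt [:: a.+2] n (mzv R) - starv a n).
Proof.
elim/ltn_ind: n => n IH.
suff I : ideal (alt [:: a.+2] n (mzv R) - starv a n).
  split=> //; have := mzv_spanD (alt_mzv_span a n) (spanN (ideal_span I)).
  by rewrite opprB addrC subrK.
rewrite alt_mzv big_ord_recl /= mzv_nil !mul1r subn0 addrC addKr.
apply: ideal_sum => -[j jn] /=; rewrite /bump add1n -mulrA.
apply: ideal_sign; rewrite mulrC; apply: idealM; last exact: twos_ideal.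
have [|//] := IH (n - j.+1.*2)%N.
by rewrite doubleS; lia.
Qed.

Lemma zeta_starM ks ls : index_pos ks -> index_pos ls ->
  zeta_star R ks * zeta_star R ls = \sum_(w <- stuffle ks ls) zeta_star R w.
Proof.
have [_ _ ZM] := zeta_star_polyP R; move=> pk pl.
by rewrite /zeta_star -hornerM ZM // horner_sum.
Qed.

Lemma zeta_star_mzv ks : admissible ks -> zeta_star R ks = mzv R ks.
Proof.
by have [Za _ _] := zeta_star_polyP R; move=> /Za E; rewrite /zeta_star E hornerC.
Qed.

Lemma alt_zeta_star a n : alt [:: a.+2] n (zeta_star R) = alt [:: a.+2] n (mzv R).
Proof.
have [s /allP sa sE] := @alt_admissible R a.+2 n isT; rewrite !sE.
by apply: eq_big_seq => p /sa ap; rewrite zeta_star_mzv.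
Qed.

Lemma sumn_ones n : sumn (ones n) = n.
Proof. by rewrite sumn_nseq mul1n. Qed.

Lemma rev_ones n : rev (ones n) = ones n.
Proof. by rewrite rev_nseq. Qed.

(** The summand with empty reversed part is split off; in the others the reversed part is [ones i ++
    [:: k]], which matches [altM]. *)
Lemma zeta_star_F_hook k n : (0 < k)%N -> zeta_star_F R (k :: ones n) =
  zeta_star R (k :: ones n) + (-1) ^+ k * alt [:: k] n (zeta_star R).
Proof.
move=> k0; rewrite /zeta_star_F /= size_nseq big_ord_recl /= zeta_star_mzv //.
rewrite mzv_nil !mul1r; congr (_ + _).
rewrite (altM _ zeta_starM) /index_pos /= ?k0 // mulr_sumr.
apply: eq_bigr => i _ /=; have iN : (i <= n)%N by rewrite -ltnS.
rewrite take_nseq // drop_nseq sumn_ones exprD rev_cons rev_ones cats1.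
by rewrite !mulrA.
Qed.

Lemma zeta_star_F_ones n : zeta_star_F R (ones n) = alt [::] n (zeta_star R).
Proof.
rewrite /zeta_star_F size_nseq (altM _ zeta_starM) //.
apply: eq_bigr => i _ /=; have iN : (i <= n)%N by rewrite -ltnS.
by rewrite take_nseq // drop_nseq sumn_ones rev_ones cats0 mulrA.
Qed.

Lemma zeta_star_F_ones_ideal n : ideal (zeta_star_F R (ones n.+2)).
Proof.
rewrite zeta_star_F_ones alt_nilE; case: odd; first exact: ideal0.
apply: ideal_sign; rewrite zeta_star_mzv ?admissible_twos //.
exact: twos_ideal.
Qed.

Lemma zeta_star_F_depth1_ideal a : ideal (zeta_star_F R [:: a.+2]).
Proof.
rewrite -[[:: _]]/(a.+2 :: ones 0) zeta_star_F_hook // alt0.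
rewrite zeta_star_mzv // -[mzv _ _]/(hook 0 a) -signr_odd /= negbK.
case: (boolP (odd a)) => oa; rewrite ?mulN1r ?subrr; first exact: ideal0.
by rewrite mul1r; apply: idealD; exact: even_zeta_ideal.
Qed.

Lemma even_zeta_products_ideal d a : ideal
  (\sum_(r < a) (1 + (-1) ^+ r) * hook 0 r * hook d (a - r).-1).
Proof.
apply: ideal_sum => r; have [or|er] := boolP (odd r).
  by rewrite -signr_odd or subrr !mul0r; exact: ideal0.
rewrite mulrC; apply: idealM; first exact: span_hook.
rewrite -signr_odd (negbTE er); apply: (@ideal_natr_mul 2).
exact: even_zeta_ideal.
Qed.

(** The right side of [hook_star] without the products of even zeta values; the grouping makes the
    symmetry in [d] and [a] visible. *)
Definition symhook d a : R :=
  (hook d.+1 a + hook d a.+1) - hook d a + ymom R d a.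

Lemma symhookC d a : symhook d a = symhook a d.
Proof.
rewrite /symhook ymom_sym (hook_dual R d a) (hook_dual R d.+1 a).
by rewrite (hook_dual R d a.+1) [hook a _ + _]addrC.
Qed.

(** Replacing [alt] in [zeta_star_F_hook] by the star value, modulo the ideal, gives the left side
    of [hook_star]. *)
Lemma zeta_star_F_symhook a d :
  ideal (zeta_star_F R (a.+2 :: ones d.+1) - symhook d a).
Proof.
have [_ I1] := starv_span_ideal a d.+1.
have I2 := even_zeta_products_ideal d a.
rewrite zeta_star_F_hook // zeta_star_mzv ?admissible_hook //.
rewrite alt_zeta_star -[mzv R _]/(hook d.+1 a) -signr_odd /= negbK signr_odd.
have := idealB (ideal_sign a I1) I2; congr (ideal _).
have := hook_star R d a; rewrite -/(symhook d a) => /eqP.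
rewrite -subr_eq => /eqP; rewrite /= => <-.
rewrite mulrBr; ring.
Qed.

Lemma zeta_F_eq ks ls :
  ideal (zeta_star_F R ks - zeta_star_F R ls) -> zeta_F R ks = zeta_F R ls.
Proof.
move=> I; apply/seteqP; split=> _ [y Iy <-].
  exists (zeta_star_F R ks - zeta_star_F R ls + y); first exact: idealD.
  ring.
exists (- (zeta_star_F R ks - zeta_star_F R ls) + y).
  by apply: idealD Iy; exact: idealN.
ring.
Qed.

End ModuloZeta2.

Theorem theorem1p3 (R : realType) (k n : nat) (hk : (0 < k)%N) (hn : (0 < n)%N) :
  zeta_F R (k :: nseq n.-1 1%N) = zeta_F R (n :: nseq k.-1 1%N).
Proof.
(* When exactly one of [k] and [n] is 1, one index is a string of ones and the other has depth one,
   and both values lie in the ideal. When neither is 1, [symhookC] applies. *)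
case: k n hk hn => [|[|a]] [|[|d]] // _ _; apply: zeta_F_eq.
- exact: idealB (zeta_star_F_ones_ideal R d) (zeta_star_F_depth1_ideal R d).
- exact: idealB (zeta_star_F_depth1_ideal R a) (zeta_star_F_ones_ideal R a).
have := idealB (zeta_star_F_symhook R a d) (zeta_star_F_symhook R d a).
by rewrite (symhookC R d a) opprB addrA subrK.
Qed.
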